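(* Let $a<b$ be real numbers and let $G_1,\ldots,G_r$ be complex functions that are holomorphic on the closed strip $\{s\in\mathbb{C}: \mathrm{Re}(s)\in[a,b]\}$, satisfy $\overline{G_i(s)}=G_i(\overline{s})$ for all $s$ in the strip, and satisfy, for all $\sigma\in[a,b]$ and all real $t$, \[ C_1\exp\left(-C_2 e^{C_3|t|}\right) < |G_i(\sigma+it)| \] for some constants $C_1,C_2>0$ and $0<C_3<\frac{\pi}{b-a}$. Suppose $f$ is holomorphic on the strip $\mathrm{Re}(s)\in[a,b]$ and satisfies $|f(\sigma+it)|<C_1\exp\left(C_2e^{C_3|t|}\right)$ for all $\sigma\in[a,b]$ and real $t$. Suppose there are real numbers $\alpha_1,\ldots,\alpha_r\ge 0$ and $\beta_1,\ldots,\beta_r\ge 0$ such that for all real $t$ \[ |f(a+it)|\le \prod_{i=1}^r |G_i(a+it)|^{\alpha_i} \quad\text{and}\quad |f(b+it)|\le \prod_{i=1}^r |G_i(b+it)|^{\beta_i}. \] Finally suppose that for every real $t$, the function $\sigma\mapsto |G_i(\sigma+it)|$ on $[a,b]$ is increasing whenever $\alpha_i>\beta_i$ and decreasing whenever $\beta_i>\alpha_i$. Then for all $a\le\sigma\le b$ and all real $t$, \[ |f(\sigma+it)| \le \left(\prod_{i=1}^r |G_i(\sigma+it)|^{\alpha_i}\right)^{\frac{b-\sigma}{b-a}}\left(\prod_{i=1}^r |G_i(\sigma+it)|^{\beta_i}\right)^{\frac{\sigma-a}{b-a}}. \]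
   Context: Here $s=\sigma+it$ with $\sigma,t$ real. The constants $C_1,C_2,C_3$ are the same in the growth conditions for the $G_i$ and for $f$. *)

(* Defs.v *)
From Stdlib Require Export Reals.
From mathcomp Require Export all_boot.
From Coquelicot Require Export Coquelicot.

Set Implicit Arguments.
Unset Strict Implicit.
Unset Printing Implicit Defensive.

Open Scope R_scope.

Definition closed_strip (a b : R) (s : C) : Prop := a <= Re s <= b.

(* A function is holomorphic on a set that need not be open when it is complex
   differentiable at every point of some open set containing it; its values
   away from that open set are irrelevant. *)
Definition holomorphic_on (S : C -> Prop) (f : C -> C) : Prop :=
  exists U : C -> Prop,
    [/\ open U,
        (forall s : C, S s -> U s)
      & forall s : C, U s -> @ex_derive C_AbsRing C_NormedModule f s].

(* prod_i |G_i(s)|^(e_i).  [Rpower x y] is exp (y * ln x), hence the real power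
   x^y only when 0 < x; it is used here for nonvanishing [G i s]. *)
Definition abs_power_prod (r : nat) (G : 'I_r -> C -> C) (e : 'I_r -> R)
    (s : C) : R :=
  \big[Rmult/1]_(i < r) Rpower (Cmod (G i s)) (e i).

Definition increasing_on (a b : R) (h : R -> R) : Prop :=
  forall x y : R, a <= x -> x <= y -> y <= b -> h x <= h y.

Definition decreasing_on (a b : R) (h : R -> R) : Prop :=
  forall x y : R, a <= x -> x <= y -> y <= b -> h y <= h x.

(* Main.v *)
(* The comparison function of the classical Phragmén–Lindelöf argument is f times
   the powers G_i^w with w(s) = -(alpha_i (b - s) + beta_i (s - a)) / (b - a), but
   Im w and arg G_i spoil it away from the real axis.  For a fixed height t, replace
   f(s) by f(s) f~(s) and log G_i by the sum of log G_i and its reflection, where ~ is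
   Schwarz reflection in the line Im s = t, and shift w so that it is real on that
   line.  By the Cauchy-Riemann equations, |G_i| increasing (decreasing) in Re s makes
   arg G_i increasing (decreasing) in Im s, so the contribution of Im w to the modulus
   of the comparison function is at most 1 everywhere and exactly 1 on the line.  The
   product is therefore bounded by 1 on the vertical sides and obeys the growth
   condition, and its value on the line is the square of the desired quotient.

   Holomorphy is only pointwise complex differentiability, so the maximum principle on
   rectangles is derived from Goursat's theorem, for the imaginary part of the contour
   integral. *)
From Stdlib Require Import Lra ClassicalEpsilon.
Require Import Defs.

Set Implicit Arguments.
Unset Strict Implicit.
Unset Printing Implicit Defensive.

(** * Complex differentiability in Caratheodory's form *)

Definition ccont (f : C -> C) (z : C) : Prop :=
  forall eps, 0 < eps -> exists d, 0 < d /\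
    forall w, Cmod (w - z) < d -> Cmod (f w - f z) < eps.

(** Keeping the slope [phi] as a function continuous at [z], with [phi z] the derivative, turns the
    sum, product and chain rules into ring identities. *)
Definition cdiff (f : C -> C) (z : C) : Prop :=
  exists phi, ccont phi z /\ forall w, f w = (f z + phi w * (w - z))%C.

Lemma Cminus_eq0 (z w : C) : (z - w)%C = 0 -> z = w.
Proof.
move=> H; have -> : z = ((z - w) + w)%C by ring.
by rewrite H; ring.
Qed.

Lemma Cmod_pos (z : C) : z <> 0 -> 0 < Cmod z.
Proof. exact: (proj1 (Cmod_gt_0 z)). Qed.

Lemma Cmod_neq0 (z : C) : 0 < Cmod z -> z <> 0.
Proof. exact: (proj2 (Cmod_gt_0 z)). Qed.

Lemma ccont_ext (f g : C -> C) z : (forall w, f w = g w) -> ccont f z -> ccont g z.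
Proof.
move=> H Hf eps /Hf [d [d0 Hd]]; exists d; split=> // w /Hd.
by rewrite !H.
Qed.

Lemma ccont_const c z : ccont (fun=> c) z.
Proof.
move=> eps e0; exists 1; split; first lra.
move=> w _; have -> : (c - c)%C = 0 by ring.
by rewrite Cmod_0.
Qed.

Lemma ccont_id z : ccont (fun w => w) z.
Proof. by move=> eps e0; exists eps. Qed.

Lemma ccont_comp f g z : ccont g z -> ccont f (g z) -> ccont (fun w => f (g w)) z.
Proof.
move=> Hg Hf eps /Hf [d [d0 Hd]]; case: (Hg d d0) => d' [d'0 Hd'].
by exists d'; split=> // w /Hd' /Hd.
Qed.

Lemma ccont_plus f g z : ccont f z -> ccont g z -> ccont (fun w => f w + g w)%C z.
Proof.
move=> Hf Hg eps e0.
case: (Hf (eps / 2)) => [|d [d0 Hd]]; first lra.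
case: (Hg (eps / 2)) => [|d' [d'0 Hd']]; first lra.
exists (Rmin d d'); split; first exact: Rmin_pos.
move=> w Hw.
have -> : (f w + g w - (f z + g z) = (f w - f z) + (g w - g z))%C by ring.
have H1 := Hd w (Rlt_le_trans _ _ _ Hw (Rmin_l _ _)).
have H2 := Hd' w (Rlt_le_trans _ _ _ Hw (Rmin_r _ _)).
have := Cmod_triangle (f w - f z) (g w - g z); lra.
Qed.

Lemma ccont_mult f g z : ccont f z -> ccont g z -> ccont (fun w => f w * g w)%C z.
Proof.
move=> Hf Hg eps e0.
have F0 := Cmod_ge_0 (f z); have G0 := Cmod_ge_0 (g z).
set A := eps / (2 * (Cmod (g z) + 1)).
(* The cap at 1 gives [Cmod (g w) <= Cmod (g z) + 1]; the [+ 1] in the denominators keeps them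
   nonzero. *)
set B := Rmin 1 (eps / (2 * (Cmod (f z) + 1))).
have A0 : 0 < A by apply: Rdiv_lt_0_compat; lra.
have B0 : 0 < B by apply: Rmin_pos; [lra | apply: Rdiv_lt_0_compat; lra].
case: (Hf A A0) => d [d0 Hd]; case: (Hg B B0) => d' [d'0 Hd'].
exists (Rmin d d'); split; first exact: Rmin_pos.
move=> w Hw.
have -> : (f w * g w - f z * g z =
  (f w - f z) * g w + f z * (g w - g z))%C by ring.
have H1 := Hd w (Rlt_le_trans _ _ _ Hw (Rmin_l _ _)).
have H2 := Hd' w (Rlt_le_trans _ _ _ Hw (Rmin_r _ _)).
have H3 : Cmod (g w) <= Cmod (g z) + 1.
  have -> : g w = ((g w - g z) + g z)%C by ring.
  have := Cmod_triangle (g w - g z) (g z); have := Rmin_l 1 (eps / (2 * (Cmod (f z) + 1))).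
  rewrite -/B; lra.
have H4 : Cmod (g w - g z) <= eps / (2 * (Cmod (f z) + 1)).
  have := Rmin_r 1 (eps / (2 * (Cmod (f z) + 1))); rewrite -/B; lra.
apply: Rle_lt_trans (Cmod_triangle _ _) _; rewrite !Cmod_mult.
have P := Cmod_ge_0 (f w - f z).
have Q := Cmod_ge_0 (g w).
have K1 : Cmod (f w - f z) * Cmod (g w) < eps / 2.
  apply: Rle_lt_trans (_ : _ <= Cmod (f w - f z) * (Cmod (g z) + 1)) _.
    exact: Rmult_le_compat_l.
  have -> : eps / 2 = A * (Cmod (g z) + 1) by rewrite /A; field; lra.
  by apply: Rmult_lt_compat_r; lra.
have K2 : Cmod (f z) * Cmod (g w - g z) <= eps / 2.
  apply: Rle_trans (_ : _ <= (Cmod (f z) + 1) * (eps / (2 * (Cmod (f z) + 1)))) _.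
    by apply: Rmult_le_compat; try exact: Cmod_ge_0; lra.
  by right; field; lra.
lra.
Qed.

Lemma ccont_inv (z : C) : z <> 0 -> ccont Cinv z.
Proof.
move=> z0 eps e0.
have m0 : 0 < Cmod z by exact: Cmod_pos.
(* The first radius keeps [Cmod w] above [Cmod z / 2]; the second then controls
   [Cmod (w - z) / (Cmod w * Cmod z)]. *)
exists (Rmin (Cmod z / 2) (eps * (Cmod z * Cmod z / 2))); split.
  by apply: Rmin_pos; [lra | apply: Rmult_lt_0_compat => //; nra].
move=> w Hw.
have H1 := Rlt_le_trans _ _ _ Hw (Rmin_l _ _).
have H2 := Rlt_le_trans _ _ _ Hw (Rmin_r _ _).
have w1 : Cmod z / 2 < Cmod w.
  have E : z = (w + - (w - z))%C by ring.
  have := Cmod_triangle w (- (w - z)); rewrite -E Cmod_opp; lra.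
have wn : w <> 0 by apply: Cmod_neq0; lra.
have -> : (/ w - / z = - ((w - z) * / (w * z)))%C by field.
rewrite Cmod_opp Cmod_mult Cmod_inv; last exact: Cmult_neq_0.
rewrite Cmod_mult.
have D : 0 < Cmod w * Cmod z by nra.
apply: (Rmult_lt_reg_r _ _ _ D).
rewrite Rmult_assoc Rinv_l; last lra.
rewrite Rmult_1_r; apply: Rlt_le_trans H2 _.
by apply: Rmult_le_compat_l; nra.
Qed.

Lemma cdiff_cont f z : cdiff f z -> ccont f z.
Proof.
move=> [phi [Hphi E]].
apply: (@ccont_ext (fun w => f z + phi w * (w + - z))%C) => [w|].
  by rewrite [RHS]E.
apply: ccont_plus; first exact: ccont_const.
apply: ccont_mult => //; apply: ccont_plus; [exact: ccont_id | exact: ccont_const].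
Qed.

Lemma cdiff_const c z : cdiff (fun=> c) z.
Proof. by exists (fun=> 0); split=> [|w]; [exact: ccont_const | ring]. Qed.

Lemma cdiff_id z : cdiff (fun w => w) z.
Proof. by exists (fun=> 1); split=> [|w]; [exact: ccont_const | ring]. Qed.

Lemma cdiff_plus f g z : cdiff f z -> cdiff g z -> cdiff (fun w => f w + g w)%C z.
Proof.
move=> [p [Hp Ef]] [q [Hq Eg]]; exists (fun w => p w + q w)%C; split.
  exact: ccont_plus.
by move=> w; rewrite (Ef w) (Eg w); ring.
Qed.

Lemma cdiff_mult f g z : cdiff f z -> cdiff g z -> cdiff (fun w => f w * g w)%C z.
Proof.
move=> Df Dg; case: (Df) => p [Hp Ef]; case: (Dg) => q [Hq Eg].
exists (fun w => p w * g w + f z * q w)%C; split.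
  apply: ccont_plus; apply: ccont_mult => //; first exact: cdiff_cont.
  exact: ccont_const.
by move=> w; rewrite (Ef w) (Eg w); ring.
Qed.

Lemma cdiff_comp f g z : cdiff g z -> cdiff f (g z) -> cdiff (fun w => f (g w)) z.
Proof.
move=> Dg [p [Hp Ef]]; case: (Dg) => q [Hq Eg].
exists (fun w => p (g w) * q w)%C; split.
  by apply: ccont_mult => //; apply: ccont_comp => //; exact: cdiff_cont.
by move=> w; rewrite Ef (Eg w); ring.
Qed.

(* Since [/ 0 = 0], the slope at [w = 0] has to be [1 / z ^ 2]. *)
Lemma cdiff_inv (z : C) : z <> 0 -> cdiff Cinv z.
Proof.
move=> z0.
exists (fun w => if Ceq_dec w 0 then / z * / z else - (/ w * / z))%C; split; last first.
  move=> w; case: (Ceq_dec w 0) => [W|w0] /=; [rewrite W | by field].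
  have -> : (/ 0 = 0)%C.
    by rewrite /Cinv /= /RtoC; congr pair; rewrite /Rdiv; ring.
  by field.
have C0 : ccont (fun w => - (1) * (/ w * / z))%C z.
  apply: ccont_mult; first exact: ccont_const.
  apply: ccont_mult; [exact: ccont_inv | exact: ccont_const].
have m0 : 0 < Cmod z by exact: Cmod_pos.
move=> eps /C0 [d [d0 Hd]].
exists (Rmin d (Cmod z)); split; first exact: Rmin_pos.
move=> w Hw.
case: (Ceq_dec z 0) => [//|z1] /=; case: (Ceq_dec w 0) => [W|w1] /=.
  have := Rlt_le_trans _ _ _ Hw (Rmin_r _ _).
  rewrite W; have -> : (0 - z = - z)%C by ring.
  rewrite Cmod_opp; lra.
have := Hd w (Rlt_le_trans _ _ _ Hw (Rmin_l _ _)).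
by have -> : (- (1) * (/ w * / z) - - (1) * (/ z * / z) = - (/ w * / z) - - (/ z * / z))%C by ring.
Qed.

Lemma cdiff_div f g z : cdiff f z -> cdiff g z -> g z <> 0 ->
  cdiff (fun w => f w / g w)%C z.
Proof.
move=> Df Dg g0; apply: cdiff_mult => //.
by apply: (@cdiff_comp Cinv) => //; exact: cdiff_inv.
Qed.

Lemma cdiff_pow f n z : cdiff f z -> cdiff (fun w => f w ^ n)%C z.
Proof.
move=> Df; elim: n => [|n IH]; first exact: cdiff_const.
exact: cdiff_mult.
Qed.

Lemma ccont_local f g z r : 0 < r -> (forall w, Cmod (w - z) < r -> f w = g w) ->
  ccont f z -> ccont g z.
Proof.
move=> r0 E Hf eps /Hf [d [d0 Hd]]; exists (Rmin d r); split; first exact: Rmin_pos.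
move=> w Hw.
have zz : Cmod (z - z) < r.
  have -> : (z - z)%C = 0 by ring.
  by rewrite Cmod_0.
rewrite -!E //; first by apply: Hd; exact: Rlt_le_trans Hw (Rmin_l _ _).
exact: Rlt_le_trans Hw (Rmin_r _ _).
Qed.

Lemma cdiff_local f g z r : 0 < r -> (forall w, Cmod (w - z) < r -> f w = g w) ->
  cdiff f z -> cdiff g z.
Proof.
move=> r0 E [p [Hp Ef]].
have zz : Cmod (z - z) < r.
  have -> : (z - z)%C = 0 by ring.
  by rewrite Cmod_0.
(* The identity in [cdiff] is demanded at every [w]. The added quotient restores it away from [z]
   and vanishes near [z], so continuity is unaffected. *)
exists (fun w => p w + (g w - f w) / (w - z))%C; split.
  apply: (ccont_local r0 _ Hp) => w Hw; rewrite -E // /Cdiv; ring.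
move=> w; have Ez := E z zz; case: (Ceq_dec w z) => [W|n].
  by rewrite W; ring.
have n' : (w - z)%C <> 0 by move=> H; apply: n; exact: Cminus_eq0.
by rewrite -Ez (Ef w); field.
Qed.

Lemma cdiff_ex_derive f z : @ex_derive C_AbsRing C_NormedModule f z -> cdiff f z.
Proof.
move=> [l [_ Hl]].
have {}Hl := Hl z (fun P HP => HP).
exists (fun w => if Ceq_dec w z then l else (f w - f z) / (w - z))%C; split; last first.
  move=> w; case: (Ceq_dec w z) => [W|n] /=.
    have A (u v t : C) : u = (u + t * (v - v))%C by ring.
    by rewrite W; exact: A.
  have A (u v x : C) : x <> 0 -> u = (v + (u - v) / x * x)%C by move=> x0; field.
  by apply: A => H; apply: n; exact: Cminus_eq0.
move=> eps e0.
(* The differentiability estimate is non-strict; halving [eps] makes the final inequality strict. *)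
have e2 : 0 < eps / 2 by lra.
have [d Hd] := Hl (mkposreal _ e2).
exists d; split; first exact: cond_pos.
move=> w Hw; case: (Ceq_dec z z) => [z1|//] /=.
case: (Ceq_dec w z) => [W|n] /=.
  have A (u : C) : Cmod (u - u) = 0 by rewrite -Cmod_0; congr Cmod; ring.
  by rewrite A.
have n' : (w - z)%C <> 0 by move=> H; apply: n; exact: Cminus_eq0.
have m0 : 0 < Cmod (w - z) by exact: Cmod_pos.
have K : Cmod (f w - f z - (w - z) * l) <= eps / 2 * Cmod (w - z) := Hd w Hw.
have A (u v x k : C) : x <> 0 -> ((u - v) / x - k = (u - v - x * k) / x)%C.
  by move=> x0; field.
rewrite A // Cmod_div //.
apply: (Rmult_lt_reg_r _ _ _ m0); rewrite /Rdiv Rmult_assoc Rinv_l; last lra.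
apply: Rle_lt_trans (_ : _ <= eps / 2 * Cmod (w - z)) _; last nra.
by rewrite Rmult_1_r.
Qed.

Definition reflect_at (t : R) (s : C) : C := (Re s, 2 * t - Im s).

(* Schwarz reflection in the line [Im s = t]. *)
Lemma cdiff_reflect f t z : cdiff f (reflect_at t z) ->
  cdiff (fun s => Cconj (f (reflect_at t s))) z.
Proof.
move=> [p [Hp E]].
have K w : (reflect_at t w - reflect_at t z = Cconj (w - z))%C.
  by rewrite /reflect_at /Cconj /Cminus /Cplus /Copp /Re /Im /=; congr pair; ring.
exists (fun s => Cconj (p (reflect_at t s))); split; last first.
  by move=> w; rewrite E K Cplus_conj Cmult_conj Cconj_conj.
move=> eps /Hp [d [d0 Hd]]; exists d; split=> // w Hw.
by rewrite -Cminus_conj Cmod_conj; apply: Hd; rewrite K Cmod_conj.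
Qed.

(** * Goursat's theorem on rectangles *)

Definition on_rect (P : C -> Prop) (x0 x1 y0 y1 : R) : Prop :=
  forall x y, x0 <= x <= x1 -> y0 <= y <= y1 -> P (x, y).

Definition on_bdry (P : C -> Prop) (x0 x1 y0 y1 : R) : Prop :=
  forall x y, x0 <= x <= x1 -> y0 <= y <= y1 ->
  x = x0 \/ x = x1 \/ y = y0 \/ y = y1 -> P (x, y).

(* The imaginary part of the counterclockwise integral of [f z dz] along the
   boundary of the rectangle. *)
Definition flux (f : C -> C) (x0 x1 y0 y1 : R) : R :=
  RInt (fun x => Im (f (x, y0)) - Im (f (x, y1))) x0 x1 +
  RInt (fun y => Re (f (x1, y)) - Re (f (x0, y))) y0 y1.

Lemma im_le_Cmod (c : C) : Rabs (Im c) <= Cmod c.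
Proof. exact: Rle_trans (Rmax_r _ _) (Rmax_Cmod c). Qed.

Lemma Cmod_R_le (x y : R) : Cmod (x, y) <= Rabs x + Rabs y.
Proof.
have -> : ((x, y) : C) = (RtoC x + Ci * RtoC y)%C.
  by rewrite /Cplus /Cmult /=; congr pair; ring.
apply: Rle_trans (Cmod_triangle _ _) _.
by rewrite Cmod_mult Cmod_Ci !Cmod_R; lra.
Qed.

Lemma continuous_eps (g : R -> R) x :
  (forall eps, 0 < eps -> exists d, 0 < d /\
    forall u, Rabs (u - x) < d -> Rabs (g u - g x) < eps) -> continuous g x.
Proof.
move=> H; apply/filterlim_locally => eps.
case: (H eps (cond_pos eps)) => d [d0 Hd].
by exists (mkposreal d d0) => u Hu; apply: Hd.
Qed.

Lemma ccont_Im_x f x y : ccont f (x, y) -> continuous (fun u => Im (f (u, y))) x.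
Proof.
move=> Hf; apply: continuous_eps => eps /Hf [d [d0 Hd]].
exists d; split=> // u Hu; apply: Rle_lt_trans (im_le_Cmod (f (u, y) - f (x, y))) _.
apply: Hd; have -> : ((u, y) - (x, y))%C = RtoC (u - x).
  by rewrite /Cminus /Cplus /Copp /RtoC /=; congr pair; ring.
by rewrite Cmod_R.
Qed.

Lemma ccont_Re_y f x y : ccont f (x, y) -> continuous (fun u => Re (f (x, u))) y.
Proof.
move=> Hf; apply: continuous_eps => eps /Hf [d [d0 Hd]].
exists d; split=> // u Hu; apply: Rle_lt_trans (re_le_Cmod (f (x, u) - f (x, y))) _.
apply: Hd; have -> : ((x, u) - (x, y))%C = (Ci * RtoC (u - y))%C.
  by rewrite /Cminus /Cplus /Copp /RtoC /Cmult /=; congr pair; ring.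
by rewrite Cmod_mult Cmod_Ci Cmod_R; lra.
Qed.

Lemma ex_RInt_Im_x f a b y : a <= b ->
  (forall x, a <= x <= b -> ccont f (x, y)) -> ex_RInt (fun x => Im (f (x, y))) a b.
Proof.
move=> ab fc; apply: ex_RInt_continuous => z.
by rewrite Rmin_left // Rmax_right // => Hz; apply: ccont_Im_x; exact: fc.
Qed.

Lemma ex_RInt_Re_y f x a b : a <= b ->
  (forall y, a <= y <= b -> ccont f (x, y)) -> ex_RInt (fun y => Re (f (x, y))) a b.
Proof.
move=> ab fc; apply: ex_RInt_continuous => z.
by rewrite Rmin_left // Rmax_right // => Hz; apply: ccont_Re_y; exact: fc.
Qed.

Lemma flux_ext f g x0 x1 y0 y1 : x0 <= x1 -> y0 <= y1 ->
  on_bdry (fun z => f z = g z) x0 x1 y0 y1 -> flux f x0 x1 y0 y1 = flux g x0 x1 y0 y1.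
Proof.
move=> hx hy E; rewrite /flux; congr (_ + _); apply: RInt_ext => t;
  rewrite Rmin_left // Rmax_right // => Ht; rewrite !E //; lra || auto.
Qed.

Lemma flux_edges f x0 x1 y0 y1 : x0 <= x1 -> y0 <= y1 ->
  on_bdry (ccont f) x0 x1 y0 y1 ->
  [/\ ex_RInt (fun x => Im (f (x, y0))) x0 x1, ex_RInt (fun x => Im (f (x, y1))) x0 x1,
      ex_RInt (fun y => Re (f (x0, y))) y0 y1 & ex_RInt (fun y => Re (f (x1, y))) y0 y1].
Proof.
move=> hx hy fc; split; [apply: ex_RInt_Im_x | apply: ex_RInt_Im_x |
  apply: ex_RInt_Re_y | apply: ex_RInt_Re_y] => // t Ht; apply: fc; lra || auto.
Qed.

Lemma fluxE f x0 x1 y0 y1 : x0 <= x1 -> y0 <= y1 -> on_bdry (ccont f) x0 x1 y0 y1 ->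
  flux f x0 x1 y0 y1 =
  RInt (fun x => Im (f (x, y0))) x0 x1 - RInt (fun x => Im (f (x, y1))) x0 x1 +
  (RInt (fun y => Re (f (x1, y))) y0 y1 - RInt (fun y => Re (f (x0, y))) y0 y1).
Proof.
move=> hx hy /flux_edges [] // *.
by rewrite /flux; congr (_ + _); apply: RInt_minus.
Qed.

Lemma flux_bound f x0 x1 y0 y1 M : x0 <= x1 -> y0 <= y1 ->
  on_bdry (ccont f) x0 x1 y0 y1 -> on_bdry (fun z => Cmod (f z) <= M) x0 x1 y0 y1 ->
  Rabs (flux f x0 x1 y0 y1) <= 2 * M * ((x1 - x0) + (y1 - y0)).
Proof.
move=> hx hy /flux_edges [] // *.
have B (u v c d : R) : Rabs u <= c -> Rabs v <= d -> Rabs (u - v) <= c + d.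
  move=> ? ?; apply: Rle_trans (Rabs_triang _ _) _; rewrite Rabs_Ropp; lra.
rewrite /flux; apply: Rle_trans (Rabs_triang _ _) _.
have H1 : Rabs (RInt (fun x => Im (f (x, y0)) - Im (f (x, y1))) x0 x1) <= (x1 - x0) * (M + M).
  apply: abs_RInt_le_const => //; first exact: (ex_RInt_minus (V := R_NormedModule)).
  move=> x Hx; apply: B; apply: Rle_trans (im_le_Cmod _) _; auto with real.
have H2 : Rabs (RInt (fun y => Re (f (x1, y)) - Re (f (x0, y))) y0 y1) <= (y1 - y0) * (M + M).
  apply: abs_RInt_le_const => //; first exact: (ex_RInt_minus (V := R_NormedModule)).
  move=> x Hx; apply: B; apply: Rle_trans (re_le_Cmod _) _; auto with real.
lra.
Qed.

Lemma on_rect_bdry (P : C -> Prop) x0 x1 y0 y1 :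
  on_rect P x0 x1 y0 y1 -> on_bdry P x0 x1 y0 y1.
Proof. by move=> H x y Hx Hy _; exact: H. Qed.

Lemma on_rect_sub (P : C -> Prop) x0 x1 y0 y1 a b c d :
  x0 <= a -> b <= x1 -> y0 <= c -> d <= y1 ->
  on_rect P x0 x1 y0 y1 -> on_rect P a b c d.
Proof. by move=> ? ? ? ? H x y Hx Hy; apply: H; lra. Qed.

Lemma on_rect_impl (P Q : C -> Prop) x0 x1 y0 y1 :
  (forall z, P z -> Q z) -> on_rect P x0 x1 y0 y1 -> on_rect Q x0 x1 y0 y1.
Proof. by move=> H K x y Hx Hy; apply: H; apply: K. Qed.

Lemma flux_split_x f x0 x1 y0 y1 m : x0 <= m <= x1 -> y0 <= y1 ->
  on_rect (ccont f) x0 x1 y0 y1 ->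
  flux f x0 x1 y0 y1 = flux f x0 m y0 y1 + flux f m x1 y0 y1.
Proof.
move=> [h1 h2] hy fc.
rewrite !fluxE //; try lra; try by apply: on_rect_bdry; apply: (on_rect_sub _ _ _ _ fc); lra.
have S y : y0 <= y <= y1 ->
  RInt (fun x => Im (f (x, y))) x0 m + RInt (fun x => Im (f (x, y))) m x1 =
  RInt (fun x => Im (f (x, y))) x0 x1.
  move=> Hy; apply: (RInt_Chasles (V := R_CompleteNormedModule)).
    by apply: ex_RInt_Im_x => // x Hx; apply: fc; lra.
  by apply: ex_RInt_Im_x => // x Hx; apply: fc; lra.
rewrite -!S; lra.
Qed.

Lemma flux_split_y f x0 x1 y0 y1 m : x0 <= x1 -> y0 <= m <= y1 ->
  on_rect (ccont f) x0 x1 y0 y1 ->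
  flux f x0 x1 y0 y1 = flux f x0 x1 y0 m + flux f x0 x1 m y1.
Proof.
move=> hx [h1 h2] fc.
rewrite !fluxE //; try lra; try by apply: on_rect_bdry; apply: (on_rect_sub _ _ _ _ fc); lra.
have S x : x0 <= x <= x1 ->
  RInt (fun y => Re (f (x, y))) y0 m + RInt (fun y => Re (f (x, y))) m y1 =
  RInt (fun y => Re (f (x, y))) y0 y1.
  move=> Hx; apply: (RInt_Chasles (V := R_CompleteNormedModule)).
    by apply: ex_RInt_Re_y => // y Hy; apply: fc; lra.
  by apply: ex_RInt_Re_y => // y Hy; apply: fc; lra.
rewrite -!S; lra.
Qed.

Lemma flux_plus f g x0 x1 y0 y1 : x0 <= x1 -> y0 <= y1 ->
  on_bdry (ccont f) x0 x1 y0 y1 -> on_bdry (ccont g) x0 x1 y0 y1 ->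
  flux (fun z => f z + g z)%C x0 x1 y0 y1 = flux f x0 x1 y0 y1 + flux g x0 x1 y0 y1.
Proof.
move=> hx hy fc gc; rewrite !fluxE //; last first.
  by move=> x y Hx Hy Hb; apply: ccont_plus; [apply: fc | apply: gc].
have [f1 f2 f3 f4] := flux_edges hx hy fc; have [g1 g2 g3 g4] := flux_edges hx hy gc.
have -> := RInt_plus _ _ _ _ f1 g1; have -> := RInt_plus _ _ _ _ f2 g2.
have -> := RInt_plus _ _ _ _ f3 g3; have -> := RInt_plus _ _ _ _ f4 g4.
rewrite /plus /=; lra.
Qed.

(** Differences across opposite edges are constant, namely [Re B] times a signed side length, so the
    two integrals cancel. *)
Lemma flux_affine (A B z0 : C) x0 x1 y0 y1 :
  flux (fun z => A + B * (z - z0))%C x0 x1 y0 y1 = 0.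
Proof.
rewrite /flux.
rewrite (@RInt_ext R_CompleteNormedModule _ (fun=> Re B * (y0 - y1))) => [|x _]; last first.
  by rewrite /Im /Re /=; ring.
rewrite (@RInt_ext R_CompleteNormedModule _ (fun=> Re B * (x1 - x0)) y0 y1) => [|x _]; last first.
  by rewrite /Im /Re /=; ring.
by rewrite !RInt_const /scal /= /mult /=; ring.
Qed.

Lemma nested_intervals_inhabited (l r : nat -> R) :
  (forall n, l n <= l n.+1) -> (forall n, r n.+1 <= r n) -> (forall n, l n <= r n) ->
  exists u, forall n, l n <= u <= r n.
Proof.
move=> Hl Hr Hlr.
have lm n k : l n <= l (k + n)%N.
  elim: k => [|k IH]; first exact: Rle_refl.
  by rewrite addSn; have := Hl (k + n)%N; lra.
have rm n k : r (k + n)%N <= r n.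
  elim: k => [|k IH]; first exact: Rle_refl.
  by rewrite addSn; have := Hr (k + n)%N; lra.
have lr n m : l n <= r m.
  have := lm n m; have := rm m n; have := Hlr (n + m)%N; rewrite (addnC m n); lra.
case: (completeness (fun x => exists n, x = l n)) => [||u [Hu Hu']].
- by exists (r 0%N) => x [n ->].
- by exists (l 0%N); exists 0%N.
exists u => n; split; first by apply: Hu; exists n.
by apply: Hu' => x [m ->].
Qed.

(** Repeated quartering. A rectangle whose flux exceeds [eps] times its squared half-perimeter has a
    quarter with the same property. The nested rectangles shrink to a point, where differentiability
    contradicts this. *)
Lemma flux_goursat f x0 x1 y0 y1 : x0 <= x1 -> y0 <= y1 ->
  on_rect (cdiff f) x0 x1 y0 y1 -> flux f x0 x1 y0 y1 = 0.
Proof.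
move=> hx hy Df.
have fc : on_rect (ccont f) x0 x1 y0 y1.
  by move: Df; apply: on_rect_impl => z; exact: cdiff_cont.
set L := (x1 - x0) + (y1 - y0).
have L0 : 0 <= L ^ 2 by exact: pow2_ge_0.
suff K eps : 0 < eps -> Rabs (flux f x0 x1 y0 y1) <= eps * L ^ 2.
  case: (Req_dec (flux f x0 x1 y0 y1) 0) => // /Rabs_pos_lt P.
  have e0 : 0 < Rabs (flux f x0 x1 y0 y1) / (2 * (L ^ 2 + 1)).
    by apply: Rdiv_lt_0_compat; lra.
  have := K _ e0.
  have E : Rabs (flux f x0 x1 y0 y1) =
    Rabs (flux f x0 x1 y0 y1) / (2 * (L ^ 2 + 1)) * (2 * (L ^ 2 + 1)) by field; lra.
  nra.
move=> e0; apply: Rnot_lt_le => bad0.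
pose s (n : nat) := (1 / 2) ^ n.
have s0 n : 0 < s n by apply: pow_lt; lra.
have sS n : s n.+1 = s n / 2 by rewrite /s /=; field.
pose W n := s n * (x1 - x0); pose H n := s n * (y1 - y0).
have W0 n : 0 <= W n by have := s0 n; rewrite /W; nra.
have H0 n : 0 <= H n by have := s0 n; rewrite /H; nra.
have WS n : W n = W n.+1 + W n.+1 by rewrite /W sS; field.
have HS n : H n = H n.+1 + H n.+1 by rewrite /H sS; field.
pose inside n (p : R * R) := x0 <= p.1 /\ p.1 + W n <= x1 /\ y0 <= p.2 /\ p.2 + H n <= y1.
pose bad n (p : R * R) := inside n p /\
  eps * (W n + H n) ^ 2 < Rabs (flux f p.1 (p.1 + W n) p.2 (p.2 + H n)).
(* The implication makes the choice total in [p], so that the sequence of corners can be defined by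
   plain recursion. *)
have step n p : {q : R * R | bad n p -> bad n.+1 q /\
    p.1 <= q.1 /\ q.1 + W n.+1 <= p.1 + W n /\ p.2 <= q.2 /\ q.2 + H n.+1 <= p.2 + H n}.
  apply: constructive_indefinite_description.
  case: (excluded_middle_informative (bad n p)) => [|nb]; last by exists p.
  case: p => x y [[/= i1 [i2 [i3 i4]]] B].
  have w0 := W0 n.+1; have h0 := H0 n.+1; have wS := WS n; have hS := HS n.
  set w := W n.+1 in w0 wS; set h := H n.+1 in h0 hS.
  apply: NNPP => N.
  (* If no quarter is bad, the four bounds [eps * (w + h) ^ 2] add up to
     [eps * (2 * w + 2 * h) ^ 2], the bound for the whole rectangle. *)
  have good u v : x <= u -> u + w <= x + W n -> y <= v -> v + h <= y + H n ->
      Rabs (flux f u (u + w) v (v + h)) <= eps * (w + h) ^ 2.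
    move=> ? ? ? ?; apply: Rnot_lt_le => b; apply: N; exists (u, v) => _.
    by split; [split=> //; rewrite /inside /= -/w -/h; lra | rewrite /= -/w -/h; lra].
  have sub : on_rect (ccont f) x (x + W n) y (y + H n).
    by apply: (on_rect_sub _ _ _ _ fc); lra.
  move: B; rewrite (@flux_split_x f _ _ _ _ (x + w)) //; try lra.
  rewrite (@flux_split_y f x (x + w) _ _ (y + h)); try lra; last first.
    by apply: (on_rect_sub _ _ _ _ sub); lra.
  rewrite (@flux_split_y f (x + w) _ _ _ (y + h)); try lra; last first.
    by apply: (on_rect_sub _ _ _ _ sub); lra.
  have -> : x + W n = x + w + w by lra.
  have -> : y + H n = y + h + h by lra.
  apply: Rle_not_lt.
  apply: Rle_trans (Rabs_triang _ _) _.
  have T1 := Rabs_triang (flux f x (x + w) y (y + h)) (flux f x (x + w) (y + h) (y + h + h)).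
  have T2 := Rabs_triang (flux f (x + w) (x + w + w) y (y + h))
    (flux f (x + w) (x + w + w) (y + h) (y + h + h)).
  have I1 := good x y ltac:(lra) ltac:(lra) ltac:(lra) ltac:(lra).
  have I2 := good x (y + h) ltac:(lra) ltac:(lra) ltac:(lra) ltac:(lra).
  have I3 := good (x + w) y ltac:(lra) ltac:(lra) ltac:(lra) ltac:(lra).
  have I4 := good (x + w) (y + h) ltac:(lra) ltac:(lra) ltac:(lra) ltac:(lra).
  rewrite wS hS; set lhs := (X in X <= _).
  have -> : eps * ((w + w + (h + h)) * ((w + w + (h + h)) * 1)) = 4 * (eps * (w + h) ^ 2) by ring.
  rewrite /lhs; lra.
pose p := fix p n := if n is m.+1 then proj1_sig (step m (p m)) else (x0, y0).
have pbad n : bad n (p n).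
  elim: n => [|n IH]; last by have [] := proj2_sig (step n (p n)) IH.
  have E1 : W 0%N = x1 - x0 by rewrite /W /s /=; ring.
  have E2 : H 0%N = y1 - y0 by rewrite /H /s /=; ring.
  split; first by rewrite /inside /= E1 E2; lra.
  rewrite /= E1 E2 -/L.
  have -> : x0 + (x1 - x0) = x1 by ring.
  by have -> : y0 + (y1 - y0) = y1 by ring.
have pS n := proj2 (proj2_sig (step n (p n)) (pbad n)).
have [u Hu] : exists u, forall n, (p n).1 <= u <= (p n).1 + W n.
  apply: nested_intervals_inhabited => n; try (have [? [? _]] := pS n); rewrite //=.
  by have := W0 n; lra.
have [v Hv] : exists v, forall n, (p n).2 <= v <= (p n).2 + H n.
  apply: nested_intervals_inhabited => n; try (have [_ [_ [? ?]]] := pS n); rewrite //=.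
  by have := H0 n; lra.
have [[i1 [i2 [i3 i4]]] _] := pbad 0%N.
have [| |phi [phic E]] := Df u v; try by [have := Hu 0%N; lra | have := Hv 0%N; lra].
have [|d [d0 Hd]] := phic (eps / 4); first lra.
(* The half-perimeter at stage [n] is [s n * L]; [L + 1] replaces [L] because the rectangle may be
   degenerate. *)
have [n Hn] : exists n, s n * (L + 1) < d.
  have L1 : 0 < L + 1 by rewrite /L; lra.
  have half1 : Rabs (1 / 2) < 1 by rewrite Rabs_pos_eq; lra.
  have [N HN] := pow_lt_1_zero _ half1 _ (Rdiv_lt_0_compat _ _ d0 L1).
  exists N; have := HN N (le_n N); rewrite Rabs_pos_eq; last exact: Rlt_le.
  move=> K; have -> : d = d / (L + 1) * (L + 1) by field; lra.
  exact: Rmult_lt_compat_r.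
have [[j1 [j2 [j3 j4]]] /Rlt_not_le] := pbad n; apply.
have {}Hu := Hu n; have {}Hv := Hv n.
set x := (p n).1 in j1 j2 Hu *; set y := (p n).2 in j3 j4 Hv *.
have WH : W n + H n < d by have := s0 n; move: Hn; rewrite /W /H /L; nra.
have w0 := W0 n; have h0 := H0 n.
set A := f (u, v); set B := phi (u, v).
have sub : on_rect (ccont f) x (x + W n) y (y + H n).
  by apply: (on_rect_sub _ _ _ _ fc).
(* Subtracting the tangent map at the limit point leaves the flux unchanged, and the remainder [e]
   is the oscillation of the slope times the distance to that point. *)
pose aff z := (A + B * (z - (u, v)))%C.
have affc z : ccont aff z.
  apply: ccont_plus; first exact: ccont_const.
  apply: ccont_mult; first exact: ccont_const.
  by apply: ccont_plus; [exact: ccont_id | exact: ccont_const].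
pose e z := (f z + (- (1)) * aff z)%C.
have ec : on_rect (ccont e) x (x + W n) y (y + H n).
  move=> a b Ha Hb; apply: ccont_plus; first exact: sub.
  by apply: ccont_mult; [exact: ccont_const | exact: affc].
have Ef : flux f x (x + W n) y (y + H n) = flux e x (x + W n) y (y + H n).
  have -> : flux f x (x + W n) y (y + H n) =
     flux (fun z => e z + aff z)%C x (x + W n) y (y + H n).
    by apply: flux_ext => [||p1 p2 _ _ _]; [lra | lra | rewrite /e; ring].
  rewrite flux_plus; try lra; [|exact: on_rect_bdry|by move=> *; exact: affc].
  by rewrite /aff flux_affine; ring.
rewrite Ef.
have -> : eps * (W n + H n) ^ 2 =
  2 * (eps / 2 * (W n + H n)) * ((x + W n - x) + (y + H n - y)) by field.
apply: flux_bound; try lra; first exact: on_rect_bdry.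
move=> a b Ha Hb _.
have M := Cmod_R_le (a - u) (b - v).
have a1 : Rabs (a - u) <= W n by apply: Rabs_le; lra.
have b1 : Rabs (b - v) <= H n by apply: Rabs_le; lra.
have -> : e (a, b) = ((phi (a, b) - phi (u, v)) * ((a, b) - (u, v)))%C.
  by rewrite /e (E (a, b)) /aff /A /B; ring.
rewrite Cmod_mult; apply: Rmult_le_compat; try exact: Cmod_ge_0.
  have := Hd (a, b); have -> : (((a, b) : C) - (u, v))%C = (a - u, b - v) by [].
  move=> /(_ ltac:(lra)); lra.
have -> : (((a, b) : C) - (u, v))%C = (a - u, b - v) by [].
lra.
Qed.

(** * The maximum principle on rectangles *)

(** Cut out a small square around the exceptional point. The four surrounding rectangles have flux 0
    by Goursat; on the square [g] is bounded by continuity, so its flux tends to 0 with the side. *)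
Lemma flux_punctured g x0 x1 y0 y1 u v : x0 < u < x1 -> y0 < v < y1 ->
  ccont g (u, v) -> on_rect (fun z => z <> (u, v) -> cdiff g z) x0 x1 y0 y1 ->
  flux g x0 x1 y0 y1 = 0.
Proof.
move=> Hu Hv gc Dg.
have cont : on_rect (ccont g) x0 x1 y0 y1.
  move=> x y Hx Hy; case: (Ceq_dec (x, y) (u, v)) => [->|n] //.
  by apply: cdiff_cont; exact: Dg.
case: (gc 1) => [|d [d0 Hd]]; first lra.
pose r0 := Rmin (Rmin (u - x0) (x1 - u)) (Rmin (v - y0) (y1 - v)).
have r00 : 0 < r0 by do !apply: Rmin_pos; lra.
have [R1 R2] : r0 <= Rmin (u - x0) (x1 - u) /\ r0 <= Rmin (v - y0) (y1 - v).
  by split; [exact: Rmin_l | exact: Rmin_r].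
have R3 := Rmin_l (u - x0) (x1 - u); have R4 := Rmin_r (u - x0) (x1 - u).
have R5 := Rmin_l (v - y0) (y1 - v); have R6 := Rmin_r (v - y0) (y1 - v).
pose M := Cmod (g (u, v)) + 1.
have M0 : 0 < M by have := Cmod_ge_0 (g (u, v)); rewrite /M; lra.
have sq h : 0 < h -> h <= r0 -> h < d / 2 -> Rabs (flux g x0 x1 y0 y1) <= 8 * M * h.
  move=> h0 hr hd.
  have D0 a b a' b' : x0 <= a -> a <= b -> b <= x1 -> y0 <= a' -> a' <= b' -> b' <= y1 ->
      (forall x y, a <= x <= b -> a' <= y <= b' -> x <> u \/ y <> v) -> flux g a b a' b' = 0.
    move=> ? ? ? ? ? ? N; apply: flux_goursat => // x y Hx Hy; apply: Dg; try lra.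
    by move=> [? ?]; case: (N x y).
  rewrite (@flux_split_x g _ _ _ _ (u - h)) //; try lra.
  rewrite (@flux_split_x g (u - h) _ _ _ (u + h)) //; try lra; last first.
    by apply: (on_rect_sub _ _ _ _ cont); lra.
  rewrite (@flux_split_y g (u - h) _ _ _ (v - h)) //; try lra; last first.
    by apply: (on_rect_sub _ _ _ _ cont); lra.
  rewrite (@flux_split_y g (u - h) _ (v - h) _ (v + h)) //; try lra; last first.
    by apply: (on_rect_sub _ _ _ _ cont); lra.
  rewrite (D0 x0 (u - h)); try lra; last by move=> *; left; lra.
  rewrite (D0 (u + h) x1); try lra; last by move=> *; left; lra.
  rewrite (D0 (u - h) (u + h) y0 (v - h)); try lra; last by move=> *; right; lra.
  rewrite (D0 (u - h) (u + h) (v + h) y1); try lra; last by move=> *; right; lra.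
  rewrite !Rplus_0_l !Rplus_0_r.
  have -> : 8 * M * h = 2 * M * ((u + h - (u - h)) + (v + h - (v - h))) by ring.
  apply: flux_bound; try lra.
    by apply: on_rect_bdry; apply: (on_rect_sub _ _ _ _ cont); lra.
  move=> x y Hx Hy _.
  have K : Cmod (((x, y) : C) - (u, v)) < d.
    apply: Rle_lt_trans (Cmod_R_le (x - u) (y - v)) _.
    have : Rabs (x - u) <= h by apply: Rabs_le; lra.
    have : Rabs (y - v) <= h by apply: Rabs_le; lra.
    lra.
  have E : g (x, y) = ((g (x, y) - g (u, v)) + g (u, v))%C by ring.
  by have := Hd _ K; have := Cmod_triangle (g (x, y) - g (u, v)) (g (u, v)); rewrite -E /M; lra.
case: (Req_dec (flux g x0 x1 y0 y1) 0) => // /Rabs_pos_lt P.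
(* The last bound makes [8 * M * h] at most half of the supposedly nonzero flux. *)
pose h := Rmin (Rmin r0 (d / 4)) (Rabs (flux g x0 x1 y0 y1) / (16 * M)).
have h0 : 0 < h by do !apply: Rmin_pos; try lra; apply: Rdiv_lt_0_compat; lra.
have h1 : h <= Rmin r0 (d / 4) by exact: Rmin_l.
have h2 : h <= Rabs (flux g x0 x1 y0 y1) / (16 * M) by exact: Rmin_r.
have h3 := Rmin_l r0 (d / 4); have h4 := Rmin_r r0 (d / 4).
have := sq h h0 ltac:(lra) ltac:(lra).
have : 8 * M * h <= 8 * M * (Rabs (flux g x0 x1 y0 y1) / (16 * M)).
  by apply: Rmult_le_compat_l; lra.
have -> : 8 * M * (Rabs (flux g x0 x1 y0 y1) / (16 * M)) = Rabs (flux g x0 x1 y0 y1) / 2.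
  by field; lra.
lra.
Qed.

Lemma ccont_kernel (z0 z : C) : z <> z0 -> ccont (fun w => / (w - z0))%C z.
Proof.
move=> n; apply: (@ccont_comp Cinv (fun w => w - z0)%C).
  by apply: ccont_plus; [exact: ccont_id | exact: ccont_const].
by apply: ccont_inv => H; apply: n; exact: Cminus_eq0.
Qed.

Lemma bdry_neq x0 x1 y0 y1 u v : x0 < u < x1 -> y0 < v < y1 ->
  on_bdry (fun z => z <> (u, v)) x0 x1 y0 y1.
Proof. by move=> Hu Hv x y Hx Hy Hb [? ?]; lra. Qed.

(* In fact the value is [2 * PI]. *)
Lemma flux_kernel_gt0 x0 x1 y0 y1 u v : x0 < u < x1 -> y0 < v < y1 ->
  0 < flux (fun z => / (z - (u, v)))%C x0 x1 y0 y1.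
Proof.
move=> Hu Hv.
have c : on_bdry (ccont (fun z => / (z - (u, v)))%C) x0 x1 y0 y1.
  by move=> x y Hx Hy Hb; apply: ccont_kernel; apply: (bdry_neq Hu Hv).
have Im_inv (p q : R) : Im (/ ((p, q) : C))%C = - (q / (p ^ 2 + q ^ 2)).
  by rewrite /Im /=; rewrite /Rdiv; ring.
have Re_inv (p q : R) : Re (/ ((p, q) : C))%C = p / (p ^ 2 + q ^ 2) by [].
have pos (p r : R) : 0 < p -> 0 <= r -> 0 < p / (p ^ 2 + r).
  by move=> p0 r0; apply: Rdiv_lt_0_compat => //; nra.
have neg (p r : R) : p < 0 -> 0 <= r -> p / (p ^ 2 + r) < 0.
  move=> p0 r0; have := pos (- p) r; have -> : (- p) ^ 2 = p ^ 2 by ring.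
  rewrite /Rdiv Ropp_mult_distr_l_reverse => /(_ ltac:(lra) r0); lra.
have E (x y : R) : (((x, y) : C) - (u, v))%C = (x - u, y - v) by [].
(* As [(u, v)] lies strictly between opposite edges, each edge contributes with the same sign, and
   both integrands are positive pointwise. *)
rewrite /flux; apply: Rplus_lt_0_compat; apply: RInt_gt_0; try lra.
- move=> x Hx; rewrite !E !Im_inv.
  rewrite ![(x - u) ^ 2 + _]Rplus_comm.
  have := pos (y1 - v) _ ltac:(lra) (pow2_ge_0 (x - u)).
  have := neg (y0 - v) _ ltac:(lra) (pow2_ge_0 (x - u)); lra.
- move=> x Hx; apply: (@continuous_minus _ R_AbsRing R_NormedModule);
    apply: (@ccont_Im_x (fun z => / (z - (u, v)))%C); apply: c; lra || auto.
- move=> y Hy; rewrite !E !Re_inv.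
  have := pos (x1 - u) _ ltac:(lra) (pow2_ge_0 (y - v)).
  have := neg (x0 - u) _ ltac:(lra) (pow2_ge_0 (y - v)); lra.
- move=> x Hx; apply: (@continuous_minus _ R_AbsRing R_NormedModule);
    apply: (@ccont_Re_y (fun z => / (z - (u, v)))%C); apply: c; lra || auto.
Qed.

(* Landau's trick: a bound with some constant for [f z0] by the boundary values
   of [f] becomes sharp when applied to the powers of [f]. *)
Lemma rect_max_principle f x0 x1 y0 y1 u v M : x0 < u < x1 -> y0 < v < y1 ->
  on_rect (cdiff f) x0 x1 y0 y1 ->
  on_bdry (fun z => Cmod (f z) <= M) x0 x1 y0 y1 -> Cmod (f (u, v)) <= M.
Proof.
move=> Hu Hv Df Hb; apply: Rnot_lt_le => N.
have M0 : 0 <= M.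
  apply: Rle_trans (Cmod_ge_0 (f (x0, y0))) _; apply: Hb; lra || auto.
have f0 : f (u, v) <> 0 by apply: Cmod_neq0; lra.
set z0 : C := (u, v) in N f0 *.
(* Normalised to be 1 at [z0]; if the claim fails, [q] is bounded on the boundary by some
   [t < 1]. *)
pose q z := (f z / f z0)%C.
pose t := M / Cmod (f z0).
have qb : on_bdry (fun z => Cmod (q z) <= t) x0 x1 y0 y1.
  move=> x y Hx Hy Hxy; rewrite /q Cmod_div //; apply: Rmult_le_compat_r.
    by apply: Rlt_le; apply: Rinv_0_lt_compat; lra.
  exact: Hb.
have t0 : 0 <= t by apply: Rmult_le_pos => //; apply: Rlt_le; apply: Rinv_0_lt_compat; lra.
have t1 : t < 1.
  apply: (Rmult_lt_reg_r (Cmod (f z0))); first lra.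
  by rewrite /t /Rdiv Rmult_assoc Rinv_l; lra.
have q1 : q z0 = 1 by rewrite /q; field.
have Dq : on_rect (cdiff q) x0 x1 y0 y1.
  move=> x y Hx Hy; apply: cdiff_mult; first exact: Df.
  exact: cdiff_const.
have K0 := flux_kernel_gt0 Hu Hv; set K := flux _ _ _ _ _ in K0.
pose r0 := Rmin (Rmin (u - x0) (x1 - u)) (Rmin (v - y0) (y1 - v)).
have r00 : 0 < r0 by do !apply: Rmin_pos; lra.
have R1 : r0 <= Rmin (u - x0) (x1 - u) by exact: Rmin_l.
have R2 : r0 <= Rmin (v - y0) (y1 - v) by exact: Rmin_r.
have R3 := Rmin_l (u - x0) (x1 - u); have R4 := Rmin_r (u - x0) (x1 - u).
have R5 := Rmin_l (v - y0) (y1 - v); have R6 := Rmin_r (v - y0) (y1 - v).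
(* The perimeter times [/ r0], which bounds the kernel [/ (z - z0)] on the boundary. *)
pose P := 2 * ((x1 - x0) + (y1 - y0)) / r0.
have est n : K <= t ^ n * P.
  (* Cauchy's formula for [q ^ n]: the slope [p] at [z0] is continuous there and differentiable
     elsewhere, so it has flux 0, and [q ^ n / (z - z0)] has the same flux [K] as the kernel. *)
  have [p [pc E]] : cdiff (fun z => q z ^ n)%C z0 by apply: cdiff_pow; apply: Dq; lra.
  have {}E w : w <> z0 -> p w = ((q w ^ n - 1) / (w - z0))%C.
    move=> n0; rewrite E q1 Cpow_1_l; field => H; apply: n0; exact: Cminus_eq0.
  have Fp : flux p x0 x1 y0 y1 = 0.
    apply: (flux_punctured Hu Hv pc) => x y Hx Hy nz.
    have nz' : ((x, y) - z0)%C <> 0 by move=> H; apply: nz; exact: Cminus_eq0.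
    (* The quotient formula for [p] fails only at [z0], which the disc of radius
       [Cmod ((x, y) - z0)] avoids. *)
    apply: (@cdiff_local (fun w => (q w ^ n + - (1)) / (w + - z0))%C _ _ (Cmod ((x, y) - z0))).
    - exact: Cmod_pos.
    - move=> w Hw; rewrite E // => W.
      have E2 : ((z0 - (x, y)) = - ((x, y) - z0))%C by ring.
      by move: Hw; rewrite W E2 Cmod_opp; lra.
    - apply: cdiff_div => //.
        by apply: cdiff_plus; [apply: cdiff_pow; apply: Dq | exact: cdiff_const].
      by apply: cdiff_plus; [exact: cdiff_id | exact: cdiff_const].
  pose kn z := (q z ^ n * / (z - z0))%C.
  have ck : on_bdry (ccont (fun z => / (z - z0))%C) x0 x1 y0 y1.
    by move=> x y Hx Hy Hxy; apply: ccont_kernel; apply: (bdry_neq Hu Hv).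
  have ckn : on_bdry (ccont kn) x0 x1 y0 y1.
    move=> x y Hx Hy Hxy; apply: ccont_mult; last exact: ck.
    by apply: cdiff_cont; apply: cdiff_pow; exact: Dq.
  have cp : on_bdry (ccont p) x0 x1 y0 y1.
    move=> x y Hx Hy Hxy.
    have nz := bdry_neq Hu Hv Hx Hy Hxy.
    have nz' : ((x, y) - z0)%C <> 0 by move=> H; apply: nz; exact: Cminus_eq0.
    apply: (@ccont_local (fun w => (q w ^ n + - (1)) * / (w - z0))%C _ _ (Cmod ((x, y) - z0))).
    - exact: Cmod_pos.
    - move=> w Hw; rewrite E // => W.
      have E2 : ((z0 - (x, y)) = - ((x, y) - z0))%C by ring.
      by move: Hw; rewrite W E2 Cmod_opp; lra.
    - apply: ccont_mult; last exact: ccont_kernel.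
      apply: ccont_plus; last exact: ccont_const.
      by apply: cdiff_cont; apply: cdiff_pow; exact: Dq.
  have EK : flux kn x0 x1 y0 y1 = K.
    rewrite (@flux_ext _ (fun z => p z + / (z - z0))%C); try lra.
      by rewrite flux_plus //; try lra; rewrite Fp Rplus_0_l.
    move=> x y Hx Hy Hxy; have nz := bdry_neq Hu Hv Hx Hy Hxy.
    rewrite E // /kn; field => H; apply: nz; exact: Cminus_eq0.
  rewrite -EK; apply: Rle_trans (Rle_abs _) _.
  have -> : t ^ n * P = 2 * (t ^ n * / r0) * ((x1 - x0) + (y1 - y0)) by rewrite /P; field; lra.
  apply: flux_bound => //; try lra.
  move=> x y Hx Hy Hxy; have nz := bdry_neq Hu Hv Hx Hy Hxy.
  have nz' : ((x, y) - z0)%C <> 0 by move=> H; apply: nz; exact: Cminus_eq0.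
  rewrite /kn Cmod_mult Cmod_pow Cmod_inv //.
  apply: Rmult_le_compat; try (apply: pow_le; exact: Cmod_ge_0).
  - by apply: Rlt_le; apply: Rinv_0_lt_compat; exact: Cmod_pos.
  - by apply: pow_incr; split; [exact: Cmod_ge_0 | exact: qb].
  - apply: Rinv_le_contravar => //.
    have A1 : Rabs (x - u) <= Cmod ((x, y) - z0) := re_le_Cmod ((x, y) - z0)%C.
    have A2 : Rabs (y - v) <= Cmod ((x, y) - z0) := im_le_Cmod ((x, y) - z0)%C.
    have B1 := Rle_abs (x - u); have B2 := Rle_abs (- (x - u)).
    have B3 := Rle_abs (y - v); have B4 := Rle_abs (- (y - v)).
    rewrite !Rabs_Ropp in B2 B4; lra.
have P0 : 0 < P by apply: Rdiv_lt_0_compat; lra.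
have t1' : Rabs t < 1 by rewrite Rabs_pos_eq.
(* [t ^ n] tends to 0, whereas [est] keeps [t ^ n * P] above the positive number [K]. *)
have [n Hn] := pow_lt_1_zero t t1' _ (Rdiv_lt_0_compat _ _ K0 P0).
have := Hn n (le_n n); rewrite Rabs_pos_eq; last exact: pow_le.
move=> {}Hn; have := est n.
have : t ^ n * P < K / P * P by exact: Rmult_lt_compat_r.
have -> : K / P * P = K by field; lra.
lra.
Qed.

(** * The complex exponential and the principal logarithm *)

Definition Cexp (z : C) : C := (exp (Re z) * cos (Im z), exp (Re z) * sin (Im z)).

Lemma Cexp_plus z w : Cexp (z + w) = (Cexp z * Cexp w)%C.
Proof.
rewrite /Cexp /Cmult /Re /Im /= exp_plus cos_plus sin_plus; congr pair; ring.
Qed.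

Lemma Cmod_Cexp z : Cmod (Cexp z) = exp (Re z).
Proof.
have E : (exp (Re z) * cos (Im z)) ^ 2 + (exp (Re z) * sin (Im z)) ^ 2 = exp (Re z) ^ 2.
  have := sin2_cos2 (Im z); rewrite /Rsqr => H.
  transitivity (exp (Re z) ^ 2 * (sin (Im z) * sin (Im z) + cos (Im z) * cos (Im z))).
    by ring.
  by rewrite H; ring.
by rewrite /Cmod /Cexp /= in E *; rewrite E -/(pow _ 2) sqrt_pow2 //; apply: Rlt_le; exact: exp_pos.
Qed.

(** The upper bound comes from [1 - x <= exp (- x)], hence [exp x * (1 - x) <= 1], while [(1 + x + 2
    * x ^ 2) * (1 - x) = 1 + x ^ 2 * (1 - 2 * x)]. *)
Lemma exp_taylor1 x : Rabs x <= 1 / 2 -> Rabs (exp x - 1 - x) <= 2 * x ^ 2.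
Proof.
move=> H; have [H1 H2] : - (1 / 2) <= x <= 1 / 2 by apply/Rabs_le_between.
have L := exp_ineq1_le x; have U := exp_ineq1_le (- x).
rewrite Rabs_pos_eq; last lra.
have P := exp_pos x.
have E : exp x * exp (- x) = 1 by rewrite -exp_plus Rplus_opp_r exp_0.
have : exp x * (1 - x) <= 1 by nra.
have : 1 <= (1 + x + 2 * x ^ 2) * (1 - x) by nra.
nra.
Qed.

Lemma sin_mvt y : exists c, Rabs c <= Rabs y /\ sin y = cos c * y.
Proof.
case: (MVT_gen sin 0 y cos) => [x _|x _|c [[c1 c2] E]].
- by apply/is_derive_Reals; exact: derivable_pt_lim_sin.
- exact: continuity_sin.
exists c; split; last by rewrite sin_0 in E; lra.
by move: c1 c2; rewrite /Rmin /Rmax /Rabs; case: Rle_dec; case: Rcase_abs; case: Rcase_abs; lra.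
Qed.

Lemma sin_abs_le y : Rabs (sin y) <= Rabs y.
Proof.
have [c [_ ->]] := sin_mvt y; rewrite Rabs_mult.
have [c1 c2] := COS_bound c.
have : Rabs (cos c) <= 1 by apply: Rabs_le; lra.
have := Rabs_pos y; nra.
Qed.

Lemma cos_taylor1 y : Rabs (cos y - 1) <= y ^ 2 / 2.
Proof.
have -> : cos y = 1 - 2 * sin (y / 2) * sin (y / 2) by rewrite -cos_2a_sin; congr cos; field.
have := sin_abs_le (y / 2) => H.
have : sin (y / 2) ^ 2 <= (y / 2) ^ 2.
  by rewrite -(pow2_abs (sin _)) -(pow2_abs (y / 2)); apply: pow_incr; split; [exact: Rabs_pos|].
have := pow2_ge_0 (sin (y / 2)) => ? ?.
rewrite Rabs_left1; nra.
Qed.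

Lemma sin_taylor1 y : Rabs y <= 1 -> Rabs (sin y - y) <= y ^ 2.
Proof.
move=> H; have [c [Hc ->]] := sin_mvt y.
have -> : cos c * y - y = (cos c - 1) * y by ring.
rewrite Rabs_mult; have := cos_taylor1 c.
rewrite -(pow2_abs c) -(pow2_abs y).
have := Rabs_pos c; have := Rabs_pos y; have := Rabs_pos (cos c - 1); nra.
Qed.

(** Follows by splitting into real and imaginary parts and using the real estimates; the constant 9
    is a crude sum of their constants. *)
Lemma Cexp_taylor1 h : Cmod h <= 1 / 2 -> Cmod (Cexp h - 1 - h) <= 9 * Cmod h ^ 2.
Proof.
move=> Hh; case: h Hh => x y Hh.
have := re_le_Cmod (x, y); have := im_le_Cmod (x, y).
set m := Cmod (x, y) in Hh *; rewrite /Re /Im /= => Hy Hx.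
have Ex := exp_taylor1 (Rle_trans _ _ _ Hx Hh).
have Ey := cos_taylor1 y; have Sy := @sin_taylor1 y ltac:(lra).
have -> : (Cexp (x, y) - 1 - (x, y))%C =
  (exp x * (cos y - 1) + (exp x - 1 - x), exp x * (sin y - y) + (exp x - 1) * y).
  by rewrite /Cexp /Cminus /Cplus /Copp /RtoC /Re /Im /=; congr pair; ring.
apply: Rle_trans (Cmod_R_le _ _) _.
have P := exp_pos x.
have Rx := Rabs_pos x; have Ry := Rabs_pos y.
rewrite -(pow2_abs x) in Ex; rewrite -(pow2_abs y) in Ey Sy.
set X := Rabs x in Ex Hx Rx; set Y := Rabs y in Ey Sy Hy Ry.
have [D1 D2] : - (2 * X) <= exp x - 1 <= 2 * X.
  have := Rle_abs x; have := Rle_abs (- x); rewrite Rabs_Ropp -/X => ? ?.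
  by move/Rabs_le_between: Ex => [? ?]; nra.
have A1 : Rabs (exp x * (cos y - 1)) <= Y ^ 2.
  rewrite Rabs_mult (Rabs_pos_eq (exp x)); last lra.
  have := Rabs_pos (cos y - 1); nra.
have A2 : Rabs (exp x * (sin y - y)) <= 2 * Y ^ 2.
  rewrite Rabs_mult (Rabs_pos_eq (exp x)); last lra.
  have := Rabs_pos (sin y - y); nra.
have A3 : Rabs ((exp x - 1) * y) <= 2 * X * Y.
  rewrite Rabs_mult -/Y; apply: Rmult_le_compat_r => //; exact: Rabs_le.
have T1 := Rabs_triang (exp x * (cos y - 1)) (exp x - 1 - x).
have T2 := Rabs_triang (exp x * (sin y - y)) ((exp x - 1) * y).
have X2 : X ^ 2 <= m ^ 2 by apply: pow_incr.
have Y2 : Y ^ 2 <= m ^ 2 by apply: pow_incr.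
have XY : X * Y <= m ^ 2 by nra.
nra.
Qed.

(** The addition law reduces this to the slope at 0. The value [phi z = Cexp z] is exposed because
    the slope of the logarithm is a reciprocal and needs it to be nonzero. *)
Lemma Cexp_slope z : exists phi, [/\ ccont phi z, phi z = Cexp z &
  forall w, Cexp w = (Cexp z + phi w * (w - z))%C].
Proof.
pose psi h := if Ceq_dec h 0 then RtoC 1 else ((Cexp h - 1) / h)%C.
have E0 : Cexp 0 = 1 by rewrite /Cexp /= exp_0 cos_0 sin_0 /RtoC; congr pair; ring.
have psi0 : psi 0 = 1 by rewrite /psi; case: (Ceq_dec 0 0).
have psiE h : Cexp h = (1 + psi h * h)%C.
  rewrite /psi; case: (Ceq_dec h 0) => [W|n] /=; first by rewrite W E0; ring.
  by field.
have psic : ccont psi 0.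
  move=> eps e0; exists (Rmin (1 / 2) (eps / 9)); split; first by apply: Rmin_pos; lra.
  move=> w; have -> : (w - 0)%C = w by ring.
  rewrite psi0 => Hw.
  have H1 : Cmod w < 1 / 2 by exact: Rlt_le_trans Hw (Rmin_l _ _).
  have H2 : Cmod w < eps / 9 by exact: Rlt_le_trans Hw (Rmin_r _ _).
  rewrite /psi; case: (Ceq_dec w 0) => [W|n] /=.
    have -> : (1 - 1)%C = 0 by ring.
    by rewrite Cmod_0.
  have m0 := Cmod_pos n.
  have -> : ((Cexp w - 1) / w - 1 = (Cexp w - 1 - w) / w)%C by field.
  rewrite Cmod_div //; apply: (Rmult_lt_reg_r _ _ _ m0).
  rewrite /Rdiv Rmult_assoc Rinv_l; last lra.
  have := @Cexp_taylor1 w ltac:(lra); nra.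
exists (fun w => Cexp z * psi (w + - z))%C; split.
- apply: ccont_mult; first exact: ccont_const.
  apply: ccont_comp; first by apply: ccont_plus; [exact: ccont_id | exact: ccont_const].
  by have -> : (z + - z)%C = 0 by ring.
- have -> : (z + - z)%C = 0 by ring.
  by rewrite psi0; ring.
- move=> w; have {1}-> : w = (z + (w + - z))%C by ring.
  by rewrite Cexp_plus (psiE (w + - z)%C); ring.
Qed.

Lemma cdiff_Cexp z : cdiff Cexp z.
Proof. by have [phi [? _ ?]] := Cexp_slope z; exists phi. Qed.

(** The principal branch on the right half plane only; elsewhere [atan (Im w / Re w)] need not be an
    argument of [w]. *)
Definition Clog (w : C) : C := (ln (Cmod w), atan (Im w / Re w)).

Lemma Cexp_Clog (w : C) : 0 < Re w -> Cexp (Clog w) = w.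
Proof.
case: w => x y; rewrite /Re /= => x0.
have m0 : 0 < Cmod (x, y) by apply: Cmod_pos => -[]; lra.
rewrite /Cexp /Clog /Re /Im /= exp_ln //.
have c0 : 0 < cos (atan (y / x)).
  by have := atan_bound (y / x) => -[? ?]; apply: cos_gt_0; lra.
have T : sin (atan (y / x)) = y / x * cos (atan (y / x)).
  by rewrite -{2}(tan_atan (y / x)) /tan; field; lra.
have M : Cmod (x, y) * cos (atan (y / x)) = x.
  have C1 : cos (atan (y / x)) = / sqrt (1 + Rsqr (y / x)).
    by rewrite cos_atan /Rdiv Rmult_1_l.
  have -> : Cmod (x, y) = x * sqrt (1 + Rsqr (y / x)).
    rewrite -{2}(sqrt_pow2 x); last lra.
    rewrite -sqrt_mult; last by have := Rle_0_sqr (y / x); lra.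
      by rewrite /Cmod /=; congr sqrt; rewrite /Rsqr; field; lra.
    exact: pow2_ge_0.
  have s0 : 0 < sqrt (1 + Rsqr (y / x)).
    by apply: sqrt_lt_R0; have := Rle_0_sqr (y / x); lra.
  by rewrite C1; field; lra.
congr pair => //.
rewrite T; transitivity (y / x * (Cmod (x, y) * cos (atan (y / x)))); first by ring.
by rewrite M; field; lra.
Qed.

Lemma ccont_real (g : C -> R) (h : R -> R) z :
  ccont (fun w => RtoC (g w)) z -> continuity_pt h (g z) -> ccont (fun w => RtoC (h (g w))) z.
Proof.
move=> Hg Hh eps e0.
have {}Hh := proj1 (continuity_pt_filterlim _ _) Hh.
have [d Hd] := proj1 (filterlim_locally _ _) Hh (mkposreal _ e0).
have [d' [d'0 Hd']] := Hg d (cond_pos d).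
exists d'; split=> // w /Hd'; rewrite -!RtoC_minus !Cmod_R => H.
exact: Hd.
Qed.

Lemma ccont_Re z : ccont (fun w => RtoC (Re w)) z.
Proof.
move=> eps e0; exists eps; split=> // w Hw; rewrite -RtoC_minus Cmod_R.
exact: Rle_lt_trans (re_le_Cmod (w - z)) Hw.
Qed.

Lemma ccont_Im z : ccont (fun w => RtoC (Im w)) z.
Proof.
move=> eps e0; exists eps; split=> // w Hw; rewrite -RtoC_minus Cmod_R.
exact: Rle_lt_trans (im_le_Cmod (w - z)) Hw.
Qed.

Lemma ccont_Cmod z : ccont (fun w => RtoC (Cmod w)) z.
Proof.
move=> eps e0; exists eps; split=> // w Hw; rewrite -RtoC_minus Cmod_R.
apply: Rle_lt_trans _ Hw; apply: Rabs_le.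
have := Cmod_triangle (w - z) z; have -> : (w - z + z)%C = w by ring.
have := Cmod_triangle (- (w - z)) w; have -> : (- (w - z) + w)%C = z by ring.
rewrite Cmod_opp; lra.
Qed.

Lemma ccont_Clog (z : C) : 0 < Re z -> ccont Clog z.
Proof.
move=> z0.
have m0 : 0 < Cmod z by apply: Rlt_le_trans z0 (Rle_trans _ _ _ (Rle_abs _) (re_le_Cmod z)).
apply: (@ccont_ext (fun w => RtoC (ln (Cmod w)) + Ci * RtoC (atan (Im w * / Re w)))%C).
  by move=> w; rewrite /Clog /Cplus /Cmult /RtoC /Ci /Rdiv /=; congr pair; ring.
apply: ccont_plus.
  apply: (@ccont_real Cmod ln); first exact: ccont_Cmod.
  by apply: derivable_continuous_pt; exists (/ Cmod z); exact: derivable_pt_lim_ln.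
apply: ccont_mult; first exact: ccont_const.
apply: (@ccont_real (fun w => Im w * / Re w) atan).
  apply: (@ccont_ext (fun w => RtoC (Im w) * RtoC (/ Re w))%C).
    by move=> w; rewrite -RtoC_mult.
  apply: ccont_mult; first exact: ccont_Im.
  apply: (@ccont_real Re Rinv); first exact: ccont_Re.
  by apply: (continuity_pt_inv (fun x => x)); [exact: continuity_pt_id | lra].
by apply: derivable_continuous_pt; exact: derivable_pt_atan.
Qed.

(** Derivative of an inverse function: the slope of [Clog] at [z] is the reciprocal of the slope of
    [Cexp], composed with the continuous [Clog]. The disc of radius [Re z] stays in the right half
    plane. *)
Lemma cdiff_Clog (z : C) : 0 < Re z -> cdiff Clog z.
Proof.
move=> z0; have [phi [phic phiz E]] := Cexp_slope (Clog z).
rewrite Cexp_Clog // in phiz E.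
have zn : z <> 0 by move=> Z; rewrite Z /= in z0; lra.
pose psi w := (/ phi (Clog w))%C.
apply: (@cdiff_local (fun w => Clog z + psi w * (w - z))%C _ _ (Re z)) => //; last first.
  exists psi; split; last by move=> w; ring.
  apply: (@ccont_comp Cinv (fun w => phi (Clog w))); last by apply: ccont_inv; rewrite phiz.
  by apply: ccont_comp => //; exact: ccont_Clog.
move=> w Hw.
have w0 : 0 < Re w.
  have : Rabs (Re w - Re z) <= Cmod (w - z) := re_le_Cmod (w - z)%C.
  by have := Rle_abs (- (Re w - Re z)); rewrite Rabs_Ropp; lra.
have := E (Clog w); rewrite Cexp_Clog // => Ew.
rewrite /psi; case: (Ceq_dec (phi (Clog w)) 0) => [P|n].
  have -> : w = z by rewrite Ew P; ring.
  by ring.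
have -> : (w - z)%C = (phi (Clog w) * (Clog w - Clog z))%C by rewrite {1}Ew; ring.
by field.
Qed.

(** * Logarithms of nonvanishing functions on rectangles *)

(** Heine-Cantor: a gauge on which [f] varies by less than [eps / 2] is chosen at each point, and
    compactness yields one [d] below the gauges of a finite cover. *)
Lemma on_rect_unif_cont f x0 x1 y0 y1 eps : 0 < eps -> on_rect (ccont f) x0 x1 y0 y1 ->
  exists d, 0 < d /\ on_rect (fun z => on_rect (fun w =>
    Rabs (Re w - Re z) < d -> Rabs (Im w - Im z) < d -> Cmod (f w - f z) < eps)
    x0 x1 y0 y1) x0 x1 y0 y1.
Proof.
move=> e0 fc.
have loc (u v : R) : {d : posreal | x0 <= u <= x1 -> y0 <= v <= y1 ->
    forall x y, Rabs (x - u) < 2 * d -> Rabs (y - v) < 2 * d ->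
      Cmod (f (x, y) - f (u, v)) < eps / 2}.
  apply: constructive_indefinite_description.
  case: (excluded_middle_informative (x0 <= u <= x1 /\ y0 <= v <= y1)) => [[Hu Hv]|n]; last first.
    by exists (mkposreal 1 Rlt_0_1) => Hu Hv; case: n.
  case: (fc u v Hu Hv (eps / 2)) => [|d [d0 Hd]]; first lra.
  have d4 : 0 < d / 4 by lra.
  (* Two coordinate differences below [2 * (d / 4)] give a distance below [d]; the factor 2 leaves
     room for a second point near the first. *)
  exists (mkposreal _ d4) => _ _ x y /= Hx Hy; apply: Hd.
  by apply: Rle_lt_trans (Cmod_R_le (x - u) (y - v)) _; lra.
case: (@compactness_value_2d x0 x1 y0 y1 (fun u v => proj1_sig (loc u v))) => d Hd.
exists d; split; first exact: cond_pos.
move=> x y Hx Hy x' y' Hx' Hy'; rewrite /Re /Im /= => Dx Dy.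
apply: NNPP => N; apply: (Hd x y Hx Hy) => -[u [v [Hu [Hv]]]].
case: (loc u v) => r /= Hr [B1 [B2 B3]]; apply: N.
have r0 := cond_pos r.
have K1 := Hr Hu Hv x y ltac:(lra) ltac:(lra).
have K2 : Cmod (f (x', y') - f (u, v)) < eps / 2.
  apply: Hr => //.
    have := Rabs_triang (x' - x) (x - u); have -> : x' - x + (x - u) = x' - u by ring.
    lra.
  have := Rabs_triang (y' - y) (y - v); have -> : y' - y + (y - v) = y' - v by ring.
  lra.
have -> : (f (x', y') - f (x, y) = (f (x', y') - f (u, v)) + - (f (x, y) - f (u, v)))%C by ring.
apply: Rle_lt_trans (Cmod_triangle _ _) _; rewrite Cmod_opp; lra.
Qed.

(* Along the segment from a corner of the rectangle to [z], cut into sufficiently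
   many pieces, consecutive values of [g] have quotients in the right half
   plane; the logarithm of [g z] is the sum of their principal logarithms. *)
Lemma log_on_rect g x0 x1 y0 y1 m : x0 <= x1 -> y0 <= y1 -> 0 < m ->
  on_rect (cdiff g) x0 x1 y0 y1 -> on_rect (fun z => m <= Cmod (g z)) x0 x1 y0 y1 ->
  exists h, on_rect (cdiff h) x0 x1 y0 y1 /\
    on_rect (fun z => Cmod (g z) = exp (Re (h z))) x0 x1 y0 y1.
Proof.
move=> hx hy m0 Dg gm.
have gc : on_rect (ccont g) x0 x1 y0 y1.
  by move: Dg; apply: on_rect_impl => z; exact: cdiff_cont.
have [d [d0 Hd]] := on_rect_unif_cont m0 gc.
set L := (x1 - x0) + (y1 - y0).
have L0 : 0 <= L by rewrite /L; lra.
(* With [N] pieces, consecutive points on a segment differ by at most [L / N < d] in each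
   coordinate. *)
have [N HN] := INR_unbounded (L / d).
have N0 : 0 < INR N.
  by apply: Rle_lt_trans HN; apply: Rmult_le_pos => //; apply: Rlt_le; exact: Rinv_0_lt_compat.
have LN : L / INR N < d.
  apply: (Rmult_lt_reg_r (INR N)) => //; rewrite /Rdiv Rmult_assoc Rinv_l; last lra.
  have : L / d * d < INR N * d by exact: Rmult_lt_compat_r.
  rewrite /Rdiv Rmult_assoc Rinv_l; lra.
pose c : C := (x0, y0).
(* The point at fraction [k / N] of the segment from the corner [c] to [z]; it is affine in [z],
   hence differentiable. *)
pose P k z := (c + RtoC (INR k / INR N) * (z + - c))%C.
have PE k x y : P k (x, y) = (x0 + INR k / INR N * (x - x0), y0 + INR k / INR N * (y - y0)).
  by rewrite /P /c /Cplus /Cmult /Copp /RtoC /=; congr pair; ring.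
have DP k z : cdiff (P k) z.
  apply: cdiff_plus; first exact: cdiff_const.
  apply: cdiff_mult; first exact: cdiff_const.
  by apply: cdiff_plus; [exact: cdiff_id | exact: cdiff_const].
have kN k : (k <= N)%N -> 0 <= INR k / INR N <= 1.
  move=> /leP/le_INR K; have K0 := pos_INR k.
  split; first by apply: Rmult_le_pos => //; apply: Rlt_le; exact: Rinv_0_lt_compat.
  apply: (Rmult_le_reg_r (INR N)) => //; rewrite /Rdiv Rmult_assoc Rinv_l; lra.
have inP (Q : C -> Prop) k x y : (k <= N)%N -> x0 <= x <= x1 -> y0 <= y <= y1 ->
    on_rect Q x0 x1 y0 y1 -> Q (P k (x, y)).
  by move=> /kN K Hx Hy; rewrite PE; apply; nra.
suff K : forall k, (k <= N)%N -> exists h, on_rect (cdiff h) x0 x1 y0 y1 /\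
    on_rect (fun z => Cmod (g (P k z)) = exp (Re (h z))) x0 x1 y0 y1.
  have [h [Dh Eh]] := K N (leqnn N); exists h; split=> // x y Hx Hy.
  rewrite -Eh // PE; congr (Cmod (g _)); congr pair; field; lra.
have gpos k x y : (k <= N)%N -> x0 <= x <= x1 -> y0 <= y <= y1 -> m <= Cmod (g (P k (x, y))).
  by move=> Hk Hx Hy; exact: (inP (fun z => m <= Cmod (g z))).
elim=> [|k IH] Hk.
  have c0 := gm x0 y0 ltac:(lra) ltac:(lra).
  (* Only the modulus of [g] has to be matched, so the real number [ln (Cmod (g c))] serves as the
     starting logarithm. *)
  exists (fun=> RtoC (ln (Cmod (g c)))); split=> x y Hx Hy; first exact: cdiff_const.
  rewrite /= exp_ln; last by rewrite /c; lra.
  rewrite PE /=; congr (Cmod (g _)); rewrite /c; congr pair; field; lra.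
have {IH} [h [Dh Eh]] := IH (ltnW Hk).
pose q z := (g (P k.+1 z) / g (P k z))%C.
have gn j x y : (j <= N)%N -> x0 <= x <= x1 -> y0 <= y <= y1 -> g (P j (x, y)) <> 0.
  by move=> Hj Hx Hy; apply: Cmod_neq0; have := gpos j x y Hj Hx Hy; lra.
have q0 x y : x0 <= x <= x1 -> y0 <= y <= y1 -> 0 < Re (q (x, y)).
  move=> Hx Hy.
  have n0 := gn k x y (ltnW Hk) Hx Hy.
  have P0 := Cmod_pos n0.
  have M := gpos k x y (ltnW Hk) Hx Hy.
  have B : Cmod (g (P k.+1 (x, y)) - g (P k (x, y))) < m.
    have K1 := kN k (ltnW Hk); have K2 := kN _ Hk.
    have S : INR k.+1 / INR N - INR k / INR N = / INR N by rewrite S_INR; field; lra.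
    have iN : 0 < / INR N by exact: Rinv_0_lt_compat.
    have bd w : 0 <= w -> w <= L ->
        Rabs (INR k.+1 / INR N * w - INR k / INR N * w) < d.
      move=> w0 wL; rewrite -Rmult_minus_distr_r S Rabs_pos_eq; last nra.
      apply: Rle_lt_trans LN; rewrite /Rdiv; nra.
    rewrite !PE; apply: Hd; rewrite /Re /Im /fst /snd; try nra.
      have -> : x0 + INR k.+1 / INR N * (x - x0) - (x0 + INR k / INR N * (x - x0)) =
        INR k.+1 / INR N * (x - x0) - INR k / INR N * (x - x0) by ring.
      by apply: bd; rewrite /L; lra.
    have -> : y0 + INR k.+1 / INR N * (y - y0) - (y0 + INR k / INR N * (y - y0)) =
      INR k.+1 / INR N * (y - y0) - INR k / INR N * (y - y0) by ring.
    by apply: bd; rewrite /L; lra.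
  (* The increment of [g] is below [m], the lower bound of its modulus, so the quotient lies in the
     unit disc around 1. *)
  have Q : Cmod (q (x, y) - 1) < 1.
    have -> : (q (x, y) - 1 = (g (P k.+1 (x, y)) - g (P k (x, y))) / g (P k (x, y)))%C.
      by rewrite /q; field.
    rewrite Cmod_div //; apply: (Rmult_lt_reg_r _ _ _ P0).
    rewrite /Rdiv Rmult_assoc Rinv_l; lra.
  have : Rabs (Re (q (x, y)) - 1) <= Cmod (q (x, y) - 1) := re_le_Cmod (q (x, y) - 1)%C.
  have := Rle_abs (- (Re (q (x, y)) - 1)); rewrite Rabs_Ropp; lra.
exists (fun z => h z + Clog (q z))%C; split=> x y Hx Hy.
  apply: cdiff_plus; first exact: Dh.
  apply: cdiff_comp; last by apply: cdiff_Clog; exact: q0.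
  apply: cdiff_div; last exact: gn (ltnW Hk) _ _.
    by apply: cdiff_comp; [exact: DP | exact: (inP (cdiff g))].
  by apply: cdiff_comp; [exact: DP | apply: (inP (cdiff g)) => //; exact: ltnW].
have n0 := gn k x y (ltnW Hk) Hx Hy.
have n1 := gn _ x y Hk Hx Hy.
have -> : Re (h (x, y) + Clog (q (x, y)))%C = Re (h (x, y)) + ln (Cmod (q (x, y))) by [].
rewrite exp_plus -Eh // exp_ln; last first.
  by rewrite /q Cmod_div //; apply: Rdiv_lt_0_compat; exact: Cmod_pos.
by rewrite -Cmod_mult; congr Cmod; rewrite /q; field.
Qed.

(* By the Cauchy-Riemann equations the derivative of [Im h] along a vertical line
   is that of [Re h] along the horizontal one. *)
Lemma Im_increasing h a b x y0 y1 : a < b -> a <= x <= b -> y0 <= y1 ->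
  (forall y, y0 <= y <= y1 -> cdiff h (x, y)) ->
  (forall y, y0 <= y <= y1 -> increasing_on a b (fun s => Re (h (s, y)))) ->
  Im (h (x, y0)) <= Im (h (x, y1)).
Proof.
move=> ab Hx Hy Dh Mh.
have D y : y0 <= y <= y1 -> exists l, 0 <= l /\ is_derive (fun v => Im (h (x, v))) y l.
  move=> Hy'; have [p [pc E]] := Dh y Hy'; exists (Re (p (x, y))); split.
    apply: Rnot_lt_le => N.
    have [|d [d0 Hd]] := pc (- Re (p (x, y))); first lra.
    have neg s : Rabs (s - x) < d -> Re (p (s, y)) < 0.
      move=> Hs; have : Cmod (p (s, y) - p (x, y)) < - Re (p (x, y)).
        apply: Hd; have -> : ((s, y) - (x, y))%C = RtoC (s - x).
          by rewrite /Cminus /Cplus /Copp /RtoC /=; congr pair; ring.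
        by rewrite Cmod_R.
      have : Rabs (Re (p (s, y)) - Re (p (x, y))) <= Cmod (p (s, y) - p (x, y)) :=
        re_le_Cmod (p (s, y) - p (x, y))%C.
      by have := Rle_abs (Re (p (s, y)) - Re (p (x, y))); lra.
    have slope s : Re (h (s, y)) = Re (h (x, y)) + Re (p (s, y)) * (s - x).
      by rewrite (E (s, y)) /Re /=; ring.
    (* A negative slope would make [Re h] strictly decrease near [x]; the comparison point is taken
       to the right of [x], or to the left when [x = b]. *)
    case: (Rlt_dec x b) => xb.
      pose s := x + Rmin (d / 2) (b - x).
      have s1 : 0 < Rmin (d / 2) (b - x) by apply: Rmin_pos; lra.
      have s2 := Rmin_l (d / 2) (b - x); have s3 := Rmin_r (d / 2) (b - x).
      have n : Re (p (s, y)) < 0 by apply: neg; rewrite /s Rabs_pos_eq; lra.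
      have /= := Mh y Hy' x s ltac:(lra) ltac:(rewrite /s; lra) ltac:(rewrite /s; lra).
      rewrite (slope s); have : 0 < s - x by rewrite /s; lra.
      nra.
    pose s := x - Rmin (d / 2) (x - a).
    have s1 : 0 < Rmin (d / 2) (x - a) by apply: Rmin_pos; lra.
    have s2 := Rmin_l (d / 2) (x - a); have s3 := Rmin_r (d / 2) (x - a).
    have n : Re (p (s, y)) < 0 by apply: neg; rewrite /s Rabs_left1; lra.
    have /= := Mh y Hy' s x ltac:(rewrite /s; lra) ltac:(rewrite /s; lra) ltac:(lra).
    rewrite (slope s); have : s - x < 0 by rewrite /s; lra.
    nra.
  apply/is_derive_Reals => eps e0.
  have [d [d0 Hd]] := pc eps e0; exists (mkposreal d d0) => k k0 /= Hk.
  have -> : (Im (h (x, y + k)) - Im (h (x, y))) / k - Re (p (x, y)) =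
      Re (p (x, Rplus y k) - p (x, y))%C.
    by rewrite (E (x, y + k)) /Im /Re /=; field.
  apply: Rle_lt_trans (re_le_Cmod _) _; apply: Hd.
  have -> : ((x, Rplus y k) - (x, y))%C = (Ci * RtoC k)%C.
    by rewrite /Cminus /Cplus /Copp /RtoC /Cmult /=; congr pair; ring.
  by rewrite Cmod_mult Cmod_Ci Cmod_R Rmult_1_l.
case: (@MVT_gen (fun v => Im (h (x, v))) y0 y1 (Derive (fun v => Im (h (x, v))))).
- move=> y; rewrite Rmin_left // Rmax_right // => Hy'; apply: Derive_correct.
  by have [|l [_ Dl]] := D y; [lra | exists l].
- move=> y; rewrite Rmin_left // Rmax_right // => Hy'.
  have [l [_ Dl]] := D y Hy'; apply/continuity_pt_filterlim.
  by apply: (@ex_derive_continuous R_AbsRing R_NormedModule); exists l.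
move=> c; rewrite Rmin_left // Rmax_right // => -[Hc].
by have [l [l0 Dl]] := D c Hc; rewrite (is_derive_unique _ _ _ Dl); nra.
Qed.

(** * The comparison function *)

Definition interp (a b al be s : R) : R := (al * (b - s) + be * (s - a)) / (b - a).

Lemma interp_bounds a b al be s : a < b -> 0 <= al -> 0 <= be -> a <= s <= b ->
  0 <= interp a b al be s <= al + be.
Proof.
move=> ab al0 be0 Hs; have iv : 0 < / (b - a) by apply: Rinv_0_lt_compat; lra.
split; first by apply: Rmult_le_pos; [nra | lra].
apply: (Rmult_le_reg_r (b - a)); first lra.
rewrite /interp /Rdiv Rmult_assoc Rinv_l; last lra.
nra.
Qed.

Lemma interp_a a b al be : a < b -> interp a b al be a = al.
Proof. by move=> ab; rewrite /interp; field; lra. Qed.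

Lemma interp_b a b al be : a < b -> interp a b al be b = be.
Proof. by move=> ab; rewrite /interp; field; lra. Qed.

(* [h] is a logarithm of [g], [P] is [- interp (s)] times the sum of [h] and its
   reflection, which is real on the line [Im s = t]; monotonicity makes the
   imaginary part of that sum have the sign that makes its contribution to
   [Re P] nonpositive. *)
Lemma reflected_log_weight g a b al be t T m :
  a < b -> 0 < m -> 0 <= T ->
  on_rect (cdiff g) a b (t - T) (t + T) ->
  on_rect (fun z => m <= Cmod (g z)) a b (t - T) (t + T) ->
  (forall y, be < al -> increasing_on a b (fun s => Cmod (g (s, y)))) ->
  (forall y, al < be -> decreasing_on a b (fun s => Cmod (g (s, y)))) ->
  exists P, [/\ on_rect (cdiff P) a b (t - T) (t + T),
    forall s, a <= s <= b ->
      Re (P (s, t)) = - 2 * (interp a b al be s * ln (Cmod (g (s, t)))) &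
    forall s u, a <= s <= b -> Rabs u <= T ->
      Re (P (s, t + u)) <=
      - (interp a b al be s * (ln (Cmod (g (s, t + u))) + ln (Cmod (g (s, t - u)))))].
Proof.
move=> ab m0 T0 Dg gm inc dec.
have tT : t - T <= t + T by lra.
have [h [Dh Eh]] := log_on_rect (Rlt_le _ _ ab) tT m0 Dg gm.
have lnE x y : a <= x <= b -> t - T <= y <= t + T -> ln (Cmod (g (x, y))) = Re (h (x, y)).
  by move=> Hx Hy; rewrite Eh // ln_exp.
(* The affine function of [z - i t] that equals [- interp a b al be s] at [z = (s, t)]. *)
pose w z := (RtoC ((al - be) / (b - a)) * (z + - (Ci * RtoC t)) +
             RtoC ((be * a - al * b) / (b - a)))%C.
pose P z := (w z * (h z + Cconj (h (reflect_at t z))))%C.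
have PE s u : Re (P (s, t + u)) =
    - (interp a b al be s * (Re (h (s, t + u)) + Re (h (s, t - u)))) -
    (al - be) / (b - a) * u * (Im (h (s, t + u)) - Im (h (s, t - u))).
  have R : reflect_at t (s, t + u) = (s, t - u).
    by rewrite /reflect_at /=; congr pair; ring.
  by rewrite /P R /w /interp /Re /Im /=; field; lra.
have ReM x x' y : a <= x <= b -> a <= x' <= b -> t - T <= y <= t + T ->
    Cmod (g (x, y)) <= Cmod (g (x', y)) -> Re (h (x, y)) <= Re (h (x', y)).
  move=> Hx Hx' Hy; rewrite !Eh // => L; apply: Rnot_lt_le => /exp_increasing; lra.
exists P; split.
- move=> x y Hx Hy; apply: cdiff_mult.
    apply: cdiff_plus; last exact: cdiff_const.
    apply: cdiff_mult; first exact: cdiff_const.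
    by apply: cdiff_plus; [exact: cdiff_id | exact: cdiff_const].
  apply: cdiff_plus; first exact: Dh.
  by apply: cdiff_reflect; apply: Dh; rewrite /=; lra.
- move=> s Hs; have := PE s 0; rewrite Rplus_0_r Rminus_0_r => ->.
  by rewrite lnE //; [ring | lra].
move=> s u Hs /Rabs_le_between Hu; rewrite PE !lnE //; try lra.
(* This is the product of the two imaginary parts: [Im w] is [(al - be) / (b - a) * u], and the
   difference of [Im h] comes from adding the reflection. *)
suff : 0 <= (al - be) * (u * (Im (h (s, t + u)) - Im (h (s, t - u)))).
  have iv : 0 < / (b - a) by apply: Rinv_0_lt_compat; lra.
  move=> K; have : 0 <= / (b - a) * ((al - be) * (u * (Im (h (s, t + u)) - Im (h (s, t - u))))).
    by apply: Rmult_le_pos; lra.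
  rewrite /Rdiv; lra.
case: (Rtotal_order al be) => [lt|[->|gt]]; last 1 first.
- have mono y0 y1 : t - T <= y0 -> y0 <= y1 -> y1 <= t + T -> Im (h (s, y0)) <= Im (h (s, y1)).
    move=> h1 h2 h3; apply: (Im_increasing ab Hs h2) => y Hy; first by apply: Dh; lra.
    move=> x x' h4 h5 h6; apply: ReM; try lra.
    exact: (inc y).
  apply: Rmult_le_pos; first lra.
  case: (Rle_dec 0 u) => u0.
    by have := mono (t - u) (t + u) ltac:(lra) ltac:(lra) ltac:(lra); nra.
  by have := mono (t + u) (t - u) ltac:(lra) ltac:(lra) ltac:(lra); nra.
- have mono y0 y1 : t - T <= y0 -> y0 <= y1 -> y1 <= t + T -> Im (h (s, y1)) <= Im (h (s, y0)).
    move=> h1 h2 h3.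
    (* Decreasing modulus is the increasing case for [- h]. *)
    have := @Im_increasing (fun z => RtoC (- 1) * h z)%C a b s y0 y1 ab Hs h2.
    have -> : Im (RtoC (- 1) * h (s, y0))%C = - Im (h (s, y0)) by rewrite /Im /Re /=; ring.
    have -> : Im (RtoC (- 1) * h (s, y1))%C = - Im (h (s, y1)) by rewrite /Im /Re /=; ring.
    move=> K; suff : - Im (h (s, y0)) <= - Im (h (s, y1)) by lra.
    apply: K => y Hy.
      by apply: cdiff_mult; [exact: cdiff_const | apply: Dh; lra].
    move=> x x' h4 h5 h6.
    have -> : Re (RtoC (- 1) * h (x, y))%C = - Re (h (x, y)) by rewrite /Im /Re /=; ring.
    have -> : Re (RtoC (- 1) * h (x', y))%C = - Re (h (x', y)) by rewrite /Im /Re /=; ring.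
    apply: Ropp_le_contravar; apply: ReM; try lra.
    exact: (dec y).
  suff : 0 <= (be - al) * (u * (Im (h (s, t - u)) - Im (h (s, t + u)))) by nra.
  apply: Rmult_le_pos; first lra.
  case: (Rle_dec 0 u) => u0.
    by have := mono (t - u) (t + u) ltac:(lra) ltac:(lra) ltac:(lra); nra.
  by have := mono (t + u) (t - u) ltac:(lra) ltac:(lra) ltac:(lra); nra.
- by rewrite Rminus_diag; lra.
Qed.

(** The witnesses are given only by existence for each [i]; adding them one at a time along the list
    avoids choosing them all at once. *)
Lemma sum_reflected (I : eqType) (l : seq I) x0 x1 t T (A : I -> R -> R) (B : I -> R -> R -> R) :
  (forall i, exists P, [/\ on_rect (cdiff P) x0 x1 (t - T) (t + T),
    forall s, x0 <= s <= x1 -> Re (P (s, t)) = A i s &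
    forall s u, x0 <= s <= x1 -> Rabs u <= T -> Re (P (s, t + u)) <= B i s u]) ->
  exists P, [/\ on_rect (cdiff P) x0 x1 (t - T) (t + T),
    forall s, x0 <= s <= x1 -> Re (P (s, t)) = \big[Rplus/0]_(i <- l) A i s &
    forall s u, x0 <= s <= x1 -> Rabs u <= T ->
      Re (P (s, t + u)) <= \big[Rplus/0]_(i <- l) B i s u].
Proof.
move=> H; elim: l => [|i l [P [DP P1 P2]]].
  exists (fun=> RtoC 0); split=> [x y _ _|s _|s u _ _]; rewrite ?big_nil //.
    exact: cdiff_const.
  exact: Rle_refl.
have [Q [DQ Q1 Q2]] := H i; exists (fun z => Q z + P z)%C; split.
- by move=> x y Hx Hy; apply: cdiff_plus; [exact: DQ | exact: DP].
- by move=> s Hs; rewrite big_cons -Q1 // -P1.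
- move=> s u Hs Hu; rewrite big_cons; exact: Rplus_le_compat (Q2 _ _ Hs Hu) (P2 _ _ Hs Hu).
Qed.

Lemma abs_power_prodE r (G : 'I_r -> C -> C) (e : 'I_r -> R) s :
  abs_power_prod G e s = exp (\big[Rplus/0]_(i < r) (e i * ln (Cmod (G i s)))).
Proof. by rewrite (big_morph exp exp_plus exp_0). Qed.

(* The witness is [2 cos (k (z - (a + b) / 2 - i t))]. *)
Lemma decay_function a b t k : a < b -> 0 < k -> k * (b - a) < PI ->
  exists E c, [/\ 0 < c, forall z, cdiff E z &
    forall s u, a <= s <= b -> c * exp (k * Rabs u) <= Re (E (s, t + u))].
Proof.
move=> ab k0 kPI.
pose q : C := ((a + b) / 2, t).
pose E z := (Cexp ((Ci * RtoC k) * (z + - q)) + Cexp ((Ci * RtoC (- k)) * (z + - q)))%C.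
have EE s u : Re (E (s, t + u)) =
    (exp (- (k * u)) + exp (k * u)) * cos (k * (s - (a + b) / 2)).
  rewrite /E /q /Cexp /Re /Im /Cmult /Cplus /Copp /=.
  have -> : (0 * k - 1 * 0) * (s + - ((a + b) / 2)) - (0 * 0 + 1 * k) * (t + u + - t) =
    - (k * u) by ring.
  have -> : (0 * - k - 1 * 0) * (s + - ((a + b) / 2)) - (0 * 0 + 1 * - k) * (t + u + - t) =
    k * u by ring.
  have -> : (0 * k - 1 * 0) * (t + u + - t) + (0 * 0 + 1 * k) * (s + - ((a + b) / 2)) =
    k * (s - (a + b) / 2) by ring.
  have -> : (0 * - k - 1 * 0) * (t + u + - t) + (0 * 0 + 1 * - k) * (s + - ((a + b) / 2)) =
    - (k * (s - (a + b) / 2)) by ring.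
  by rewrite cos_neg; ring.
exists E, (cos (k * (b - a) / 2)); split.
- by apply: cos_gt_0; [have := PI_RGT_0; nra | lra].
- move=> z; apply: cdiff_plus; (apply: cdiff_comp; last exact: cdiff_Cexp);
    (apply: cdiff_mult; first exact: cdiff_const);
    by apply: cdiff_plus; [exact: cdiff_id | exact: cdiff_const].
move=> s u Hs; rewrite EE Rmult_comm.
have c0 : 0 < cos (k * (b - a) / 2) by apply: cos_gt_0; [have := PI_RGT_0; nra | lra].
have -> : cos (k * (s - (a + b) / 2)) = cos (Rabs (k * (s - (a + b) / 2))).
  by rewrite /Rabs; case: Rcase_abs => // _; rewrite cos_neg.
(* Since [k * (b - a) / 2 < PI / 2], the cosine is smallest, and still positive, on the sides of the
   strip; [c] is that minimum. *)
have B : Rabs (k * (s - (a + b) / 2)) <= k * (b - a) / 2 by apply: Rabs_le; nra.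
have C : cos (k * (b - a) / 2) <= cos (Rabs (k * (s - (a + b) / 2))).
  have P := Rabs_pos (k * (s - (a + b) / 2)).
  by apply: cos_decr_1; lra.
apply: Rmult_le_compat => //; try exact: Rlt_le; first exact: Rlt_le (exp_pos _).
have P1 := exp_pos (- (k * u)); have P2 := exp_pos (k * u).
rewrite /Rabs; case: Rcase_abs => _; last lra.
have -> : k * - u = - (k * u) by ring.
lra.
Qed.

Lemma sum_scal (I : Type) (l : seq I) (c : R) (F : I -> R) :
  \big[Rplus/0]_(i <- l) (c * F i) = c * \big[Rplus/0]_(i <- l) F i.
Proof.
elim: l => [|i l IH]; first by rewrite !big_nil Rmult_0_r.
by rewrite !big_cons IH; ring.
Qed.

Lemma sum_add (I : Type) (l : seq I) (F F' : I -> R) :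
  \big[Rplus/0]_(i <- l) (F i + F' i) =
  \big[Rplus/0]_(i <- l) F i + \big[Rplus/0]_(i <- l) F' i.
Proof.
elim: l => [|i l IH]; first by rewrite !big_nil Rplus_0_r.
by rewrite !big_cons IH; ring.
Qed.

Lemma sum_le (I : Type) (l : seq I) (F F' : I -> R) : (forall i, F i <= F' i) ->
  \big[Rplus/0]_(i <- l) F i <= \big[Rplus/0]_(i <- l) F' i.
Proof.
move=> H; elim: l => [|i l IH]; first by rewrite !big_nil; exact: Rle_refl.
by rewrite !big_cons; exact: Rplus_le_compat.
Qed.

(** Used on the horizontal sides, where the damping of rate [k] must beat the growth of rate
    [C3]. *)
Lemma exp_dominates K eps k k' : 0 <= K -> 0 < eps -> k' < k ->
  exists T, 0 < T /\ K * exp (k' * T) <= eps * exp (k * T).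
Proof.
move=> K0 e0 kk.
have p0 : 0 < eps * (k - k') by nra.
(* With this [T], [eps * (k - k') * T] exceeds [K], and [exp x >= 1 + x] finishes. *)
exists (1 + K / (eps * (k - k'))).
have q0 : 0 <= K / (eps * (k - k')).
  by apply: Rmult_le_pos => //; apply: Rlt_le; exact: Rinv_0_lt_compat.
set T := 1 + _; have T0 : 0 < T by rewrite /T; lra.
split=> //.
have -> : k * T = (k - k') * T + k' * T by ring.
rewrite exp_plus -Rmult_assoc; apply: Rmult_le_compat_r; first exact: Rlt_le (exp_pos _).
have := exp_ineq1_le ((k - k') * T) => X.
have Y : K <= eps * ((k - k') * T).
  have -> : eps * ((k - k') * T) = eps * (k - k') + K by rewrite /T; field; nra.
  lra.
nra.
Qed.

(** * The Phragmén-Lindelöf argument at a fixed height *)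

Theorem theorem1p1
  (a b : R) (hab : a < b)
  (r : nat) (G : 'I_r -> C -> C) (f : C -> C)
  (C1 C2 C3 : R) (hC1 : 0 < C1) (hC2 : 0 < C2)
  (hC3 : 0 < C3) (hC3' : C3 < PI / (b - a))
  (G_holo : forall i : 'I_r, holomorphic_on (closed_strip a b) (G i))
  (G_conj : forall (i : 'I_r) (s : C), closed_strip a b s ->
     Cconj (G i s) = G i (Cconj s))
  (G_growth : forall (i : 'I_r) (sigma t : R), a <= sigma <= b ->
     C1 * exp (- C2 * exp (C3 * Rabs t)) < Cmod (G i (sigma, t)))
  (f_holo : holomorphic_on (closed_strip a b) f)
  (f_growth : forall sigma t : R, a <= sigma <= b ->
     Cmod (f (sigma, t)) < C1 * exp (C2 * exp (C3 * Rabs t)))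
  (alpha beta : 'I_r -> R)
  (alpha_ge0 : forall i : 'I_r, 0 <= alpha i)
  (beta_ge0 : forall i : 'I_r, 0 <= beta i)
  (f_left : forall t : R,
     Cmod (f (a, t)) <= abs_power_prod G alpha (a, t))
  (f_right : forall t : R,
     Cmod (f (b, t)) <= abs_power_prod G beta (b, t))
  (G_incr : forall (i : 'I_r) (t : R), beta i < alpha i ->
     increasing_on a b (fun sigma : R => Cmod (G i (sigma, t))))
  (G_decr : forall (i : 'I_r) (t : R), alpha i < beta i ->
     decreasing_on a b (fun sigma : R => Cmod (G i (sigma, t)))) :
  forall sigma t : R, a <= sigma <= b ->
    Cmod (f (sigma, t)) <=
      Rpower (abs_power_prod G alpha (sigma, t)) ((b - sigma) / (b - a)) *
      Rpower (abs_power_prod G beta (sigma, t)) ((sigma - a) / (b - a)).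
Proof.
move=> s t Hs.
pose lg i z := ln (Cmod (G i z)).
pose e i x := interp a b (alpha i) (beta i) x.
(* The logarithm of the desired bound; its weights interpolate linearly between [alpha] and
   [beta]. *)
pose Y x y := \big[Rplus/0]_(i < r) (e i x * lg i (x, y)).
have -> : Rpower (abs_power_prod G alpha (s, t)) ((b - s) / (b - a)) *
    Rpower (abs_power_prod G beta (s, t)) ((s - a) / (b - a)) = exp (Y s t).
  rewrite !abs_power_prodE /Rpower !ln_exp -exp_plus; congr exp.
  rewrite -!sum_scal -sum_add; apply: eq_bigr => i _.
  by rewrite /e /lg /interp; field; lra.
have fa y : Cmod (f (a, y)) <= exp (Y a y).
  apply: Rle_trans (f_left y) _; rewrite abs_power_prodE; right; congr exp.
  by apply: eq_bigr => i _; rewrite /e interp_a.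
have fb y : Cmod (f (b, y)) <= exp (Y b y).
  apply: Rle_trans (f_right y) _; rewrite abs_power_prodE; right; congr exp.
  by apply: eq_bigr => i _; rewrite /e interp_b.
(* The maximum principle needs an interior point, so the two sides are settled by hypothesis. *)
case: (Req_dec s a) => [->|sa]; first exact: fa.
case: (Req_dec s b) => [->|sb]; first exact: fb.
have {}Hs : a < s < b by lra.
have PI0 := PI_RGT_0.
have C3PI : C3 * (b - a) < PI.
  have -> : PI = PI / (b - a) * (b - a) by field; lra.
  by apply: Rmult_lt_compat_r; lra.
(* The midpoint of [C3] and [PI / (b - a)]: damping of rate [k] outgrows the growth hypotheses,
   while the cosine stays positive on the strip. *)
pose k := (C3 + PI / (b - a)) / 2.
have kC3 : C3 < k by rewrite /k; lra.
have kPI : k * (b - a) < PI.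
  have -> : k * (b - a) = (C3 * (b - a) + PI) / 2 by rewrite /k; field; lra.
  lra.
have [E [c [c0 DE EB]]] := @decay_function a b t k hab ltac:(lra) kPI.
pose S := \big[Rplus/0]_(i < r) (alpha i + beta i).
have S0 : 0 <= S.
  have -> : 0 = \big[Rplus/0]_(i < r) (0 * 0) by rewrite sum_scal Rmult_0_l.
  by apply: sum_le => i; have := alpha_ge0 i; have := beta_ge0 i; lra.
(* This is the limit [eps -> 0]: if the bound failed with logarithmic excess [q > 0], then
   [eps = q / Re (E (s, t))] would give [exp (2 * q) <= exp q]. *)
suff key eps : 0 < eps -> Cmod (f (s, t)) ^ 2 * exp (- 2 * Y s t) <= exp (eps * Re (E (s, t))).
  have D0 : 0 < Re (E (s, t)).
    have := EB s 0 ltac:(lra); rewrite Rplus_0_r; have := exp_pos (k * Rabs 0); nra.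
  apply: Rnot_lt_le => N.
  pose q := ln (Cmod (f (s, t))) - Y s t.
  have EY := exp_pos (Y s t).
  have q0 : 0 < q.
    by have := ln_increasing _ _ EY N; rewrite ln_exp /q; lra.
  have qE : Cmod (f (s, t)) ^ 2 * exp (- 2 * Y s t) = exp (2 * q).
    have -> : 2 * q = ln (Cmod (f (s, t))) + ln (Cmod (f (s, t))) + - 2 * Y s t by rewrite /q; ring.
    by rewrite !exp_plus exp_ln; [ring | lra].
  have qD : q / Re (E (s, t)) * Re (E (s, t)) = q by field; lra.
  have := key _ (Rdiv_lt_0_compat _ _ q0 D0); rewrite qE qD.
  have : exp q < exp (2 * q) by apply: exp_increasing; lra.
  lra.
move=> e0.
pose L := Rabs (ln C1).
have L0 : 0 <= L by exact: Rabs_pos.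
have C1E : C1 = exp (ln C1) by rewrite exp_ln.
(* Chosen so that [K * exp (C3 * T)] dominates [2 * B + 2 * B * S], the undamped exponent on the
   horizontal sides, with [B] below. *)
pose K := exp (C3 * Rabs t) * (2 * L + 2 * C2 + 2 * S * (L + C2)).
have K0 : 0 <= K.
  have : 0 <= S * (L + C2) by apply: Rmult_le_pos; lra.
  by move=> ?; apply: Rmult_le_pos; [exact: Rlt_le (exp_pos _) | lra].
have [T [T0 HT]] := @exp_dominates K (eps * c) k C3 K0 ltac:(nra) kC3.
pose X := exp (C3 * (Rabs t + T)).
have X1 : 1 <= X.
  rewrite -exp_0; have := Rabs_pos t => ?.
  have : 0 < C3 * (Rabs t + T) by nra.
  by move/exp_increasing; rewrite /X exp_0; lra.
(* On the rectangle of half-height [T], [B] bounds [ln] of the modulus of [f] from above and [- B]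
   bounds that of each [G i] from below. *)
pose B := L + C2 * X.
have XB y : t - T <= y <= t + T -> exp (C3 * Rabs y) <= X.
  move=> Hy; have Hr : C3 * Rabs y <= C3 * (Rabs t + T).
    apply: Rmult_le_compat_l; first lra.
    have -> : y = t + (y - t) by ring.
    apply: Rle_trans (Rabs_triang _ _) _; apply: Rplus_le_compat_l; apply: Rabs_le; lra.
  by case: Hr => [/exp_increasing|->]; [exact: Rlt_le | right].
have lnC1 : - L <= ln C1 <= L by apply/Rabs_le_between; exact: Rle_refl.
have fB x y : a <= x <= b -> t - T <= y <= t + T -> Cmod (f (x, y)) <= exp B.
  move=> Hx /XB Hy; apply: Rle_trans (Rlt_le _ _ (f_growth x y Hx)) _.
  rewrite {1}C1E -exp_plus.
  have [/exp_increasing|->] : ln C1 + C2 * exp (C3 * Rabs y) <= B.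
  - by rewrite /B; nra.
  - exact: Rlt_le.
  - by right.
have GB i x y : a <= x <= b -> t - T <= y <= t + T -> exp (- B) <= Cmod (G i (x, y)).
  move=> Hx /XB Hy; apply: Rle_trans (Rlt_le _ _ (G_growth i x y Hx)).
  rewrite {1}C1E -exp_plus.
  have [/exp_increasing|->] : - B <= ln C1 + - C2 * exp (C3 * Rabs y).
  - by rewrite /B; nra.
  - exact: Rlt_le.
  - by right.
have lgB i x y : a <= x <= b -> t - T <= y <= t + T -> - B <= lg i (x, y).
  move=> Hx Hy; rewrite -(ln_exp (- B)); apply: ln_le; [exact: exp_pos | exact: GB].
have holo g : holomorphic_on (closed_strip a b) g -> on_rect (cdiff g) a b (t - T) (t + T).
  by move=> [U [_ sub D]] x y Hx _; apply: cdiff_ex_derive; apply: D; exact: sub.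
have [P [DP P1 P2]] := @sum_reflected _ (index_enum 'I_r) a b t T
  (fun i x => - 2 * (e i x * lg i (x, t)))
  (fun i x u => - (e i x * (lg i (x, t + u) + lg i (x, t - u))))
  (fun i => reflected_log_weight hab (exp_pos (- B)) (Rlt_le _ _ T0) (holo _ (G_holo i))
     (GB i) (G_incr i) (G_decr i)).
have P2' x u : a <= x <= b -> Rabs u <= T -> Re (P (x, t + u)) <= - (Y x (t + u) + Y x (t - u)).
  move=> Hx Hu; apply: Rle_trans (P2 x u Hx Hu) _; right.
  rewrite /Y -sum_add -[RHS]Rmult_1_l Ropp_mult_distr_r_reverse Ropp_mult_distr_l -sum_scal.
  by apply: eq_bigr => i _; ring.
(* [f] times its reflection, weighted by the reflected powers of the [G i] and damped by
   [exp (- eps * E)]. *)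
pose F z := (f z * Cconj (f (reflect_at t z)) * Cexp (P z + RtoC (- eps) * E z))%C.
have FE x u : Cmod (F (x, t + u)) =
    Cmod (f (x, t + u)) * Cmod (f (x, t - u)) * exp (Re (P (x, t + u)) - eps * Re (E (x, t + u))).
  have R : reflect_at t (x, t + u) = (x, t - u).
    by rewrite /reflect_at /=; congr pair; ring.
  rewrite /F R !Cmod_mult Cmod_conj Cmod_Cexp; congr (_ * exp _).
  by rewrite /Re /=; ring.
have DF : on_rect (cdiff F) a b (t - T) (t + T).
  move=> x y Hx Hy; have Df := holo _ f_holo.
  apply: cdiff_mult; first apply: cdiff_mult.
  - exact: Df.
  - by apply: cdiff_reflect; apply: Df; rewrite /=; lra.
  - apply: cdiff_comp; last exact: cdiff_Cexp.
    apply: cdiff_plus; first exact: DP.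
    by apply: cdiff_mult; [exact: cdiff_const | exact: DE].
have exp_le1 x : x <= 0 -> exp x <= 1.
  by rewrite -exp_0 => -[/exp_increasing|->]; [exact: Rlt_le | right].
have prod_le p p' q q' w : 0 <= p -> p <= exp q -> 0 <= p' -> p' <= exp q' -> q + q' + w <= 0 ->
    p * p' * exp w <= 1.
  move=> p0 pq p0' pq' H; apply: Rle_trans (exp_le1 _ H); rewrite !exp_plus.
  apply: Rmult_le_compat_r; first exact: Rlt_le (exp_pos _).
  exact: Rmult_le_compat.
have bdry : on_bdry (fun z => Cmod (F z) <= 1) a b (t - T) (t + T).
  move=> x y Hx Hy Hxy; pose u := y - t.
  have yE : y = t + u by rewrite /u; ring.
  have Hu : Rabs u <= T by apply: Rabs_le; rewrite /u; lra.
  have Hy' : t - T <= t - u <= t + T by rewrite /u; lra.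
  have PB := P2' x u Hx Hu; have EB' := EB x u Hx.
  have Epos : 0 < c * exp (k * Rabs u) by apply: Rmult_lt_0_compat => //; exact: exp_pos.
  rewrite yE FE.
  (* On the vertical sides the bounds [exp (Y x (t + u))] and [exp (Y x (t - u))] cancel against
     [P], and the damping only helps. *)
  have side : x = a \/ x = b -> Cmod (f (x, t + u)) * Cmod (f (x, t - u)) *
      exp (Re (P (x, t + u)) - eps * Re (E (x, t + u))) <= 1.
    move=> H; apply: (@prod_le _ _ (Y x (t + u)) (Y x (t - u))); try exact: Cmod_ge_0.
    - by case: H => ->.
    - by case: H => ->.
    - nra.
  case: Hxy => [H|[H|H]]; [by apply: side; left | by apply: side; right |].
  have uT : Rabs u = T.
    by rewrite /u; case: H => ->; [rewrite Rabs_left1 | rewrite Rabs_pos_eq]; lra.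
  apply: (@prod_le _ _ B B); try exact: Cmod_ge_0; try apply: fB; rewrite -?yE //.
  (* The weights lie between 0 and [alpha i + beta i], so the lower bound [- B] for each logarithm
     bounds the sum. *)
  have PB2 : Re (P (x, t + u)) <= 2 * B * S.
    apply: Rle_trans (P2 x u Hx Hu) _; rewrite -sum_scal; apply: sum_le => i.
    have [i0 i1] := interp_bounds hab (alpha_ge0 i) (beta_ge0 i) Hx.
    have l1 := lgB i x (t + u) Hx ltac:(lra); have l2 := lgB i x (t - u) Hx Hy'.
    rewrite -/(e i x) in i0 i1.
    have B0 : 0 <= B by rewrite /B; nra.
    nra.
  rewrite uT in EB'.
  have : eps * (c * exp (k * T)) <= eps * Re (E (x, t + u)) by apply: Rmult_le_compat_l; lra.
  have KX : K * exp (C3 * T) = X * (2 * L + 2 * C2 + 2 * S * (L + C2)).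
    have -> : X = exp (C3 * Rabs t) * exp (C3 * T).
      by rewrite /X -exp_plus; congr exp; ring.
    by rewrite /K; ring.
  have : B + B + 2 * B * S <= K * exp (C3 * T).
    rewrite KX /B.
    have : L <= L * X by nra.
    have : L * S <= L * S * X by have := Rmult_le_pos _ _ L0 S0; nra.
    nra.
  rewrite yE; lra.
(* At [u = 0] the point is its own reflection, so [F] has modulus
   [Cmod (f (s, t)) ^ 2 * exp (- 2 * Y s t)] times the damping. *)
have := @rect_max_principle F a b (t - T) (t + T) s t 1 Hs ltac:(lra) DF bdry.
have := FE s 0; rewrite Rplus_0_r Rminus_0_r => ->.
rewrite P1; last lra.
rewrite sum_scal -/(Y s t) /Rminus exp_plus exp_Ropp => H.
have EP := exp_pos (eps * Re (E (s, t))).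
apply: (Rmult_le_reg_r (/ exp (eps * Re (E (s, t))))); first exact: Rinv_0_lt_compat.
rewrite Rinv_r; last lra.
by apply: Rle_trans H; right; ring.
Qed.
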